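(* Let $K$ be an algebraically closed field that is complete with respect to a nontrivial ultrametric norm $|\cdot|$. Suppose that the residue characteristic of $K$ is strictly positive and that $|K^{\times}| = \{|z| : z \in K^{\times}\}$ is a proper subgroup of $\mathbb{R}_{>0}$. Let $\mathscr{D}$ be a proper divisible subgroup of the multiplicative group $\mathbb{R}_{>0}$ containing $|K^{\times}|$. Then there is a polynomial of degree at least two with coefficients in $K$ having a (bounded) Fatou component whose diameter is outside $\mathscr{D}$. In particular, there is a polynomial of degree at least two with coefficients in $K$ having a Fatou component that is an irrational disk.
   Context: A multiplicative subgroup $\mathscr{D}$ of $\mathbb{R}_{>0}$ is divisible if for all $r \in \mathscr{D}$ and all integers $n \ge 1$ there is $\widehat{r} \in \mathscr{D}$ with $\widehat{r}^n = r$. For $z_0 \in K$ and $r \in \mathbb{R}_{>0}$, the disk $\{z \in K : |z - z_0| < r\}$ is rational if $r \in |K^{\times}|$ and irrational otherwise. A rational (resp. irrational) disk of the projective line $\mathbb{P}^1_K$ is the image of a rational (resp. irrational) disk of $K$ under a Möbius transformation. Let $\mathsf{P}^1_K$ denote the Berkovich projective line over $K$. A rational map $R$ of degree at least two with coefficients in $K$ acts on $\mathsf{P}^1_K$. The Fatou set of $R$ is the set of points of $\mathsf{P}^1_K$ having an open neighborhood $U$ such that $\bigcup_{n \ge 0} R^n(U)$ omits infinitely many points of $\mathsf{P}^1_K$; a Fatou component is a connected component of the Fatou set. A Fatou component is said to be a rational or irrational disk if its intersection with $\mathbb{P}^1_K$ (the set of $K$-points) is one. The diameter of a Fatou component $U$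 whose intersection with $\mathbb{P}^1_K$ is a nonempty bounded subset of $K$ is $\sup\{|z - w| : z, w \in U \cap K\}$. *)

(* Defs.v *)
From HB Require Import structures.
From mathcomp Require Import all_boot all_order all_algebra.
From mathcomp Require Import all_classical all_reals all_analysis.

Set Implicit Arguments.
Unset Strict Implicit.
Unset Printing Implicit Defensive.

Import Order.TTheory GRing.Theory Num.Theory.
Import numFieldNormedType.Exports.

Local Open Scope classical_set_scope.
Local Open Scope ring_scope.

Record ultrametric_norm (R : realType) (K : fieldType) := UltrametricNorm {
  unorm :> K -> R;
  unorm_ge0 : forall x, 0 <= unorm x;
  unorm_eq0 : forall x, unorm x = 0 <-> x = 0;
  unormM : forall x y, unorm (x * y) = unorm x * unorm y;
  unormD : forall x y, unorm (x + y) <= Num.max (unorm x) (unorm y)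
}.

Section NormedField.
Variables (R : realType) (K : fieldType) (v : ultrametric_norm R K).

Definition nontrivial_norm : Prop := exists2 x : K, x != 0 & v x != 1.

Definition complete_norm : Prop :=
  forall u : nat -> K,
    (forall e : R, 0 < e -> exists N : nat,
       forall m n : nat, (N <= m)%N -> (N <= n)%N -> v (u m - u n) < e) ->
    exists l : K, (fun n => v (u n - l)) @ \oo --> (0 : R).

Definition value_group : set R := [set v z | z in [set z : K | z != 0]].

Lemma unorm1 : v 1 = 1.
Proof.
have n1 : v 1 != 0 by apply/eqP => /unorm_eq0/eqP; rewrite oner_eq0.
by apply: (mulfI n1); rewrite -unormM !mulr1.
Qed.

Lemma unormN x : v (- x) = v x.
Proof.
have h : v (-1) = 1.
  have : v (-1) ^+ 2 == 1 by rewrite expr2 -unormM mulrNN mulr1 unorm1.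
  rewrite sqrf_eq1 => /orP[/eqP //|/eqP e].
  by have := unorm_ge0 v (-1); rewrite e lerNr oppr0 ler10.
by rewrite -mulN1r unormM h mul1r.
Qed.

Lemma unorm0 : v 0 = 0.
Proof. exact/unorm_eq0. Qed.

Definition in_valuation_ring : {pred K} := fun x => v x <= 1.

Lemma valuation_ring_subring : subring_closed in_valuation_ring.
Proof.
split => [|x y|x y]; rewrite !unfold_in.
- by rewrite unorm1.
- move=> hx hy; apply: le_trans (unormD _ _ _) _.
  by rewrite unormN ge_max hx hy.
- by move=> hx hy; rewrite unormM mulr_ile1 // unorm_ge0.
Qed.

HB.instance Definition _ :=
  GRing.isSubringClosed.Build K in_valuation_ring valuation_ring_subring.

Record valuation_ring := ValuationRing {
  valuation_ring_val :> K;
  valuation_ringP : valuation_ring_val \in in_valuation_ring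
}.

HB.instance Definition _ := [isSub for valuation_ring_val].
HB.instance Definition _ := [Choice of valuation_ring by <:].
HB.instance Definition _ :=
  [SubChoice_isSubComNzRing of valuation_ring by <:].

Definition maximal_ideal : {pred valuation_ring} := fun x => v (val x) < 1.

Lemma maximal_ideal_closed : idealr_closed maximal_ideal.
Proof.
split; rewrite ?unfold_in /=.
- by rewrite unorm0.
- by rewrite unorm1 ltxx.
- move=> a x y; rewrite !unfold_in /= => hx hy.
  apply: le_lt_trans (unormD _ _ _) _; rewrite gt_max hy andbT unormM.
  apply: le_lt_trans hx; rewrite ler_piMl ?unorm_ge0 //.
  exact: valuation_ringP.
Qed.

HB.instance Definition _ :=
  isIdealr.Build valuation_ring maximal_ideal maximal_ideal_closed.

Definition residue_field := {ideal_quot maximal_ideal}.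
HB.instance Definition _ := GRing.ComNzRing.on residue_field.

(* residue_field is built as a commutative ring only; that maximal_ideal is
   maximal is not needed to speak of its characteristic. *)
Definition positive_residue_char : Prop := exists p, p \in [pchar residue_field].

End NormedField.

Record divisible_subgroup (R : realType) (D : set R) : Prop := {
  divsub_gt0 : D `<=` [set r | 0 < r];
  divsub1 : D 1;
  divsubM : forall r s, D r -> D s -> D (r * s);
  divsubV : forall r, D r -> D r^-1;
  divsub_root : forall r (n : nat), D r -> (1 <= n)%N ->
    exists2 s, D s & s ^+ n = r
}.

Section BerkovichLine.
Variables (R : realType) (K : fieldType) (v : ultrametric_norm R K).

(* Only the triangle inequality is required: since these seminorms extend an
   ultrametric norm, the ultrametric inequality follows. *)
Record mseminorm := MSeminorm {
  mseminorm_fun :> {poly K} -> R;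
  mseminorm_ge0 : forall p, 0 <= mseminorm_fun p;
  mseminormC : forall c : K, mseminorm_fun c%:P = v c;
  mseminormM : forall p q,
    mseminorm_fun (p * q) = mseminorm_fun p * mseminorm_fun q;
  mseminormD : forall p q,
    mseminorm_fun (p + q) <= mseminorm_fun p + mseminorm_fun q
}.

HB.instance Definition _ := gen_eqMixin mseminorm.
HB.instance Definition _ := gen_choiceMixin mseminorm.

(* Topology of pointwise convergence: the coarsest one for which every
   evaluation map s |-> s p is continuous. *)
Definition berk_affine_line : Type :=
  initial_topology (mseminorm_fun : mseminorm -> {ptws {poly K} -> R}).
HB.instance Definition _ := Topological.on berk_affine_line.

(* The Berkovich projective line is the one-point compactification of the
   (locally compact Hausdorff) affine one; None is the point at infinity. *)
Definition berk_proj_line : Type := one_point_compactification berk_affine_line.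
HB.instance Definition _ := Topological.on berk_proj_line.

Lemma eval_norm_ge0 (z : K) (p : {poly K}) : 0 <= v p.[z].
Proof. exact: unorm_ge0. Qed.

Lemma eval_normC (z c : K) : v (c%:P).[z] = v c.
Proof. by rewrite hornerC. Qed.

Lemma eval_normM (z : K) (p q : {poly K}) :
  v (p * q).[z] = v p.[z] * v q.[z].
Proof. by rewrite hornerM unormM. Qed.

Lemma eval_normD (z : K) (p q : {poly K}) :
  v (p + q).[z] <= v p.[z] + v q.[z].
Proof.
rewrite hornerD; apply: le_trans (unormD _ _ _) _.
by rewrite ge_max lerDl lerDr !unorm_ge0.
Qed.

Definition eval_mseminorm (z : K) : mseminorm :=
  MSeminorm (eval_norm_ge0 z) (eval_normC z) (eval_normM z) (eval_normD z).

(* The set P^1(K) is encoded as option K, with None the point at infinity. *)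
Definition berk_of_point (z : option K) : berk_proj_line :=
  omap (eval_mseminorm : K -> berk_affine_line) z.

Section PolynomialAction.
Variables (P : {poly K}) (s : mseminorm).

Lemma push_mseminorm_ge0 (p : {poly K}) : 0 <= s (p \Po P).
Proof. exact: mseminorm_ge0. Qed.

Lemma push_mseminormC (c : K) : s (c%:P \Po P) = v c.
Proof. by rewrite comp_polyC mseminormC. Qed.

Lemma push_mseminormM (p q : {poly K}) :
  s ((p * q) \Po P) = s (p \Po P) * s (q \Po P).
Proof. by rewrite comp_polyM mseminormM. Qed.

Lemma push_mseminormD (p q : {poly K}) :
  s ((p + q) \Po P) <= s (p \Po P) + s (q \Po P).
Proof. by rewrite comp_polyD mseminormD. Qed.

Definition push_mseminorm : mseminorm :=
  MSeminorm push_mseminorm_ge0 push_mseminormC push_mseminormM push_mseminormD.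

End PolynomialAction.

(* Sending infinity to itself is right for nonconstant P only. *)
Definition poly_action (P : {poly K}) : berk_proj_line -> berk_proj_line :=
  omap (push_mseminorm P : berk_affine_line -> berk_affine_line).

Definition fatou_set (f : berk_proj_line -> berk_proj_line) :
    set berk_proj_line :=
  [set x | exists U : set berk_proj_line, [/\ open U, U x &
     infinite_set (~` (\bigcup_(n in [set: nat]) (iter n f @` U)))]].

Definition fatou_component (f : berk_proj_line -> berk_proj_line)
    (U : set berk_proj_line) : Prop :=
  exists2 x, fatou_set f x & U = connected_component (fatou_set f) x.

Definition proj_points (U : set berk_proj_line) : set (option K) :=
  berk_of_point @^-1` U.

Definition affine_points (U : set berk_proj_line) : set K :=
  Some @^-1` proj_points U.

(* U meets P^1(K) in a nonempty bounded subset of K. *)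
Definition bounded_in_K (U : set berk_proj_line) : Prop :=
  [/\ ~ proj_points U None, affine_points U !=set0 &
      exists M : R, forall z, affine_points U z -> v z <= M].

(* sup is a junk value unless the set is nonempty and bounded above, which
   bounded_in_K U guarantees. *)
Definition diameter (U : set berk_proj_line) : R :=
  sup [set v (z - w) | z in affine_points U & w in affine_points U].

Definition mobius (a b c d : K) (z : option K) : option K :=
  if z is Some x then
    if c * x + d == 0 then None else Some ((a * x + b) / (c * x + d))
  else if c == 0 then None else Some (a / c).

Definition open_disk (z0 : K) (r : R) : set K := [set z | v (z - z0) < r].

Definition irrational_disk (B : set K) : Prop :=
  exists (z0 : K) (r : R),
    [/\ 0 < r, ~ value_group v r & B = open_disk z0 r].

Definition irrational_proj_disk (A : set (option K)) : Prop :=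
  exists (a b c d : K) (B : set K),
    [/\ a * d - b * c != 0, irrational_disk B & A = mobius a b c d @` (Some @` B)].

End BerkovichLine.

(* Main.v *)
Require Import Defs.
From HB Require Import structures.
From mathcomp Require Import all_boot all_order all_algebra.
From mathcomp Require Import all_classical all_reals all_analysis.
From mathcomp Require Import ring lra zify.

(* The radius [r] of the component is any number outside [D], taken small enough;
   the whole problem is to find a polynomial for which a disk of radius [r] is a
   maximal wandering disk. Following Benedetto, consider a family of polynomials
   [F_c] that are close to [z ^ p + theta * z + c] on a large disk about [0] and
   have a common repelling fixed point [omega] outside it. In the first region a
   disk of radius [s] is mapped to a disk of radius [max (s ^ p, |theta| s)],
   whence a strong contraction, while near [omega] radii are multiplied by a
   constant [> 1]. Let the orbit of [x0] alternate between longer and longer stays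
   in the two regions, each return to the first one occurring when the image of
   the disk of radius [r] is so large that the [p]-th power prevails. The images
   of this disk remain bounded; but for [r' > r] the ratio of the radii of the
   images of the two disks is raised to the power [p] infinitely often, so that
   the larger disk eventually covers any bounded set: the only point of the
   Berkovich line at distance [r] from [x0] is in the Julia set.
   The itinerary is realized by a limit of parameters [c] for which the orbit of
   [x0] ends at [omega]: after a long stay in the first region the orbit has
   forgotten its past and moves at the same speed as [c], hence the neighbourhood
   of [omega] amplifies a small variation of [c] and the next stays can be
   prescribed at will. *)

Set Implicit Arguments.
Unset Strict Implicit.
Unset Printing Implicit Defensive.

Import Order.TTheory GRing.Theory Num.Theory.
Import numFieldNormedType.Exports.

Local Open Scope classical_set_scope.
Local Open Scope ring_scope.
Local Open Scope quotient_scope.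

(** * Growth of powers in ordered fields *)

Lemma bernoulli_ge (R : realDomainType) (a : R) n : 1 <= a -> 1 + (a - 1) * n%:R <= a ^+ n.
Proof.
move=> a1; elim: n => [|n ih]; first by rewrite expr0; lra.
rewrite exprS -natr1.
have k0 : 0 <= (a - 1) * (a - 1) * n%:R by rewrite !mulr_ge0 // subr_ge0.
have h : a * (1 + (a - 1) * n%:R) <= a * a ^+ n by rewrite ler_wpM2l //; lra.
lra.
Qed.

Lemma exprn_unbounded (R : archiRealFieldType) (a t : R) : 1 < a -> exists n, t < a ^+ n.
Proof.
move=> a1; exists (Num.truncn (t / (a - 1))).+1; set n := Num.truncn _.
have a0 : 0 < a - 1 by lra.
have h : t < (a - 1) * n.+1%:R by rewrite -ltr_pdivrMl // mulrC truncnS_gt.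
by have := bernoulli_ge n.+1 (ltW a1); lra.
Qed.

(** * Ultrametric norms *)

Section Ultrametric.
Variables (R : realType) (K : fieldType) (v : ultrametric_norm R K).
Implicit Types (x y z : K) (r : R).

Lemma unorm_gt0 x : (0 < v x) = (x != 0).
Proof.
rewrite lt_neqAle unorm_ge0 andbT eq_sym; congr (~~ _).
by apply/eqP/eqP => [/unorm_eq0|->]; last exact: unorm0.
Qed.

Lemma unorm_distC x y : v (x - y) = v (y - x).
Proof. by rewrite -unormN opprB. Qed.

Lemma unormX x n : v (x ^+ n) = v x ^+ n.
Proof. by elim: n => [|n ih]; rewrite ?expr0 ?unorm1 // !exprS unormM ih. Qed.

Lemma unormV x : v x^-1 = (v x)^-1.
Proof.
have [->|x0] := eqVneq x 0; first by rewrite invr0 unorm0 invr0.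
have vx0 : v x != 0 by rewrite gt_eqF // unorm_gt0.
by apply: (mulfI vx0); rewrite -unormM !mulfV // unorm1.
Qed.

Lemma unorm_div x y : v (x / y) = v x / v y.
Proof. by rewrite unormM unormV. Qed.

Lemma unormD_le x y r : v x <= r -> v y <= r -> v (x + y) <= r.
Proof. by move=> hx hy; apply: le_trans (unormD _ _ _) _; rewrite ge_max hx. Qed.

Lemma unormB_le x y r : v x <= r -> v y <= r -> v (x - y) <= r.
Proof. by move=> hx hy; apply: unormD_le; rewrite ?unormN. Qed.

Lemma unormD_lt x y r : v x < r -> v y < r -> v (x + y) < r.
Proof. by move=> hx hy; apply: le_lt_trans (unormD _ _ _) _; rewrite gt_max hx. Qed.

Lemma unormB_lt x y r : v x < r -> v y < r -> v (x - y) < r.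
Proof. by move=> hx hy; apply: unormD_lt; rewrite ?unormN. Qed.

Lemma unorm_dist_lt x y z r : v (x - y) < r -> v (y - z) < r -> v (x - z) < r.
Proof. by move=> hx hy; rewrite -(subrK y x) -addrA; apply: unormD_lt. Qed.

Lemma unormDl x y : v y < v x -> v (x + y) = v x.
Proof.
move=> h; apply/eqP; rewrite eq_le unormD_le ?(ltW h) //= leNgt.
apply/negP => h1; have : v (x + y - y) < v x by exact: unormB_lt.
by rewrite addrK ltxx.
Qed.

Lemma unormDr x y : v x < v y -> v (x + y) = v y.
Proof. by rewrite addrC; exact: unormDl. Qed.

Lemma unormBl x y : v y < v x -> v (x - y) = v x.
Proof. by move=> h; rewrite unormDl // unormN. Qed.

Lemma unormBr x y : v x < v y -> v (x - y) = v y.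
Proof. by move=> h; rewrite unormDr ?unormN. Qed.

Lemma unorm_sum_le (I : Type) (s : seq I) (P : pred I) (F : I -> K) r :
  0 <= r -> (forall i, P i -> v (F i) <= r) -> v (\sum_(i <- s | P i) F i) <= r.
Proof.
move=> r0 h; elim/big_ind : _ => //; first by rewrite unorm0.
by move=> x y; exact: unormD_le.
Qed.

Lemma unorm_nat_le1 n : v n%:R <= 1.
Proof.
elim: n => [|n ih]; first by rewrite unorm0.
by rewrite -natr1; apply: unormD_le => //; rewrite unorm1.
Qed.

Lemma unormXB_le x y r n : v x <= r -> v y <= r ->
  v (x ^+ n.+1 - y ^+ n.+1) <= v (x - y) * r ^+ n.
Proof.
move=> hx hy; have r0 : 0 <= r := le_trans (unorm_ge0 v x) hx.
rewrite subrXX unormM ler_wpM2l ?unorm_ge0 //.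
apply: unorm_sum_le => [|[i /= hi] _]; first exact: exprn_ge0.
rewrite unormM !unormX /=; have -> : r ^+ n = r ^+ (n - i) * r ^+ i.
  by rewrite -exprD subnK.
by rewrite ler_pM ?exprn_ge0 ?unorm_ge0 ?lerXn2r ?nnegrE ?unorm_ge0.
Qed.

End Ultrametric.

Section ClosedUltrametric.
Variables (R : realType) (K : closedFieldType) (v : ultrametric_norm R K).
Implicit Types (x y z : K) (r : R).

(** Induction by a product rule: replacing [c0] with [c] preserves the norm of each factor [c0 - a]
    and moves the factor by less than this norm. *)
Lemma prod_dist_lt (s : seq K) (c c0 : K) :
  (forall a, a \in s -> v (c - c0) < v (a - c0)) ->
  v (\prod_(a <- s) (c - a) - \prod_(a <- s) (c0 - a)) < v (\prod_(a <- s) (c0 - a)).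
Proof.
elim: s => [|a s ih] h; first by rewrite !big_nil subrr unorm0 unorm1.
rewrite !big_cons; set A' := \prod_(a <- s) (c - a); set A := \prod_(a <- s) (c0 - a).
have {}ih : v (A' - A) < v A by apply: ih => b bs; apply: h; rewrite inE bs orbT.
have ha : v (c - c0) < v (c0 - a) by rewrite (unorm_distC v c0); apply: h; rewrite mem_head.
have ea : v (c - a) = v (c0 - a) by rewrite -(subrK c0 c) -addrA unormDr.
have -> : (c - a) * A' - (c0 - a) * A = (c - a) * (A' - A) + (c - c0) * A by ring.
have A0 : 0 < v A by apply: le_lt_trans ih; exact: unorm_ge0.
rewrite unormM; apply: unormD_lt; rewrite unormM.
  by rewrite ea ltr_pM2l //; apply: le_lt_trans ha; exact: unorm_ge0.
by rewrite ltr_pM2r.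
Qed.

(* If no root of [f - w] lies within [v (c - c0)] of [c0], then [f - w] varies
   on that disk by less than its value at the centre. *)
Lemma exists_preimage_near (f : {poly K}) (c c0 w : K) :
  v (w - f.[c0]) <= v (f.[c] - f.[c0]) ->
  exists2 c', v (c' - c0) <= v (c - c0) & f.[c'] = w.
Proof.
move=> h; pose g := f - w%:P.
have [s gE] := closed_field_poly_normal g.
have [/hasP[a sa /= ha]|] := boolP (has (fun a => v (a - c0) <= v (c - c0)) s).
  exists a => //; apply/eqP; rewrite -subr_eq0 -[w](hornerC _ a) -hornerN -hornerD.
  by rewrite -/g gE hornerZ horner_prod (big_rem a) //= hornerXsubC subrr !(mul0r,mulr0).
rewrite -all_predC => /allP hs.
have {}hs a : a \in s -> v (c - c0) < v (a - c0) by move=> /hs /=; rewrite ltNge.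
have gx x : g.[x] = lead_coef g * \prod_(a <- s) (x - a).
  rewrite {1}gE hornerZ horner_prod; congr (_ * _).
  by apply: eq_bigr => a _; rewrite hornerXsubC.
have [g0|g0] := eqVneq g 0.
  exists c0; first by rewrite subrr unorm0 unorm_ge0.
  by apply/eqP; rewrite -subr_eq0 -[w](hornerC _ c0) -hornerN -hornerD -/g g0 horner0.
have := prod_dist_lt hs; rewrite -(ltr_pM2l (_ : 0 < v (lead_coef g))); last first.
  by rewrite unorm_gt0 lead_coef_eq0.
have e1 : g.[c] - g.[c0] = f.[c] - f.[c0] by rewrite /g !hornerE; ring.
have e2 : v g.[c0] = v (w - f.[c0]) by rewrite /g !hornerE unorm_distC.
by rewrite -!unormM mulrBr -!gx e1 e2 ltNge h.
Qed.

Lemma exists_nth_root x n : (0 < n)%N -> exists z : K, z ^+ n = x.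
Proof.
move=> n0; have [|z] := closed_rootP ('X^n - x%:P) _.
  by rewrite size_XnsubC // eqSS -lt0n.
by rewrite rootE !hornerE subr_eq0 => /eqP; exists z.
Qed.

Hypothesis v_nontrivial : nontrivial_norm v.

Lemma exists_unorm_gt1 : exists x, 1 < v x.
Proof.
have [x x0 /=] := v_nontrivial; rewrite neq_lt => /orP[x1|]; last by exists x.
by exists x^-1; rewrite unormV invf_gt1 ?unorm_gt0.
Qed.

(** The norms of the successive roots of an element of norm greater than [1] tend to [1]. *)
Lemma exists_unorm_near1 r : 1 < r -> exists x, 1 < v x < r.
Proof.
move=> r1; have [x x1] := exists_unorm_gt1.
have [n hn] : exists n, v x < r ^+ n.+1.
  have [[|n] hn] := exprn_unbounded (v x) r1; last by exists n.
  by move: hn; rewrite expr0 ltNge (ltW x1).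
have [z zx] := @exists_nth_root x n.+1 isT.
exists z; rewrite -zx unormX in hn x1.
apply/andP; split; rewrite ltNge; apply/negP => h.
  by move: x1; rewrite ltNge exprn_ile1 // unorm_ge0.
by move: hn; rewrite ltNge lerXn2r // nnegrE ?unorm_ge0 //; lra.
Qed.

(** The value group is dense: for [y] with [1 < v y < r2 / r1], the powers of [y] divided by a fixed
    large power form a geometric progression that starts below [r1] and cannot jump over the
    interval. *)
Lemma exists_unorm_between r1 r2 : 0 < r2 -> r1 < r2 -> exists x, r1 < v x < r2.
Proof.
wlog r10 : r1 / 0 < r1 => [hw|_ r12].
  move=> r20 r12; have [|||x /andP[hx1 hx2]] := hw (Num.max r1 (r2 / 2)) => //.
  - by rewrite lt_max; apply/orP; right; lra.
  - by rewrite gt_max r12; lra.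
  by exists x; rewrite hx2 andbT (le_lt_trans _ hx1) // le_max lexx.
have [y /andP[y1 yr]] : exists y, 1 < v y < r2 / r1.
  by apply: exists_unorm_near1; rewrite ltr_pdivlMr ?mul1r.
have y0 : 0 < v y by lra.
have [N hN] := exprn_unbounded r1^-1 y1.
have [M hM] := exprn_unbounded (r1 * v y ^+ N) y1.
have ex : exists n, r1 < v y ^+ n / v y ^+ N.
  by exists M; rewrite ltr_pdivlMr ?exprn_gt0.
case: (ex_minnP ex) => [[|k]] hk kmin.
  move: hk; rewrite expr0 div1r ltNge => /negP[].
  by rewrite -[r1]invrK lef_pV2 ?posrE ?invr_gt0 ?exprn_gt0 // ltW.
exists (y ^+ k.+1 / y ^+ N); rewrite unorm_div !unormX hk /=.
have : ~~ (r1 < v y ^+ k / v y ^+ N) by apply/negP => /kmin; rewrite ltnn.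
rewrite -leNgt => h; rewrite exprS -mulrA.
by rewrite (le_lt_trans (ler_wpM2l (ltW y0) h)) // -ltr_pdivlMr.
Qed.

End ClosedUltrametric.

(** * Residue characteristic and the Frobenius map *)

Section ResidueCharacteristic.
Variables (R : realType) (K : fieldType) (v : ultrametric_norm R K).

Lemma residue_char_unorm_lt1 :
  positive_residue_char v -> exists2 p : nat, prime p & v p%:R < 1.
Proof.
move=> [p]; rewrite inE => /andP[pp /eqP p0]; exists p => //.
have h : (p%:R : valuation_ring v) - 0 \in maximal_ideal (v := v).
  rewrite Quotient.idealrBE; apply/eqP.
  apply: etrans (esym (rmorph0 (\pi_({ideal_quot maximal_ideal (v:=v)})))).
  exact: etrans (rmorph_nat (\pi_({ideal_quot maximal_ideal (v:=v)})) p) p0.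
have valE n : \val (n%:R : valuation_ring v) = n%:R :> K.
  by elim: n => [|n ih] //; rewrite -!natr1 -ih.
by move: h; rewrite subr0 unfold_in /= valE.
Qed.
Lemma unorm_prime_bin (p i : nat) : prime p -> (0 < i < p)%N ->
  v 'C(p, i)%:R <= v p%:R.
Proof.
move=> pp /prime_dvd_bin-/(_ pp)/dvdnP[k ->].
by rewrite natrM unormM ler_piMl ?unorm_ge0 ?unorm_nat_le1.
Qed.

(** Approximate additivity of Frobenius: every mixed term of the binomial expansion has a
    coefficient divisible by [p] and contains a factor [e]. *)
Lemma unorm_exprD_prime (p : nat) (x e : K) (B : R) : prime p ->
  1 <= B -> v x <= B -> v e <= 1 ->
  v ((x + e) ^+ p - x ^+ p - e ^+ p) <= v p%:R * (B ^+ p.-1 * v e).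
Proof.
move=> pp B1 xB e1; have B0 : 0 <= B by lra.
case: p pp => [|[|n]] // pp; rewrite exprDn big_ord_recl big_ord_recr /=.
rewrite subn0 subnn bin0 binn expr0 mulr1 mul1r !mulr1n.
rewrite [X in v X](_ : _ =
  \sum_(i < n.+1) x ^+ (n.+2 - bump 0 i) * e ^+ bump 0 i *+ 'C(n.+2, bump 0 i)); last first.
  by rewrite addrC -addrA; ring.
apply: unorm_sum_le => [|[i /= hi] _].
  by rewrite !mulr_ge0 ?exprn_ge0 ?unorm_ge0.
rewrite /bump /= add1n -mulr_natl unormM ler_pM ?unorm_ge0 //.
  by apply: unorm_prime_bin; rewrite //=; lia.
rewrite unormM !unormX ler_pM ?exprn_ge0 ?unorm_ge0 //.
  rewrite (le_trans (lerXn2r _ _ _ xB)) ?nnegrE ?unorm_ge0 //.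
  by rewrite ler_weXn2l //; lia.
by rewrite exprS ler_piMr ?unorm_ge0 // exprn_ile1 ?unorm_ge0.
Qed.
End ResidueCharacteristic.

(** * A one-parameter family *)

Section Family.
Variables (R : realType) (K : closedFieldType) (v : ultrametric_norm R K).
Variables (p : nat) (y : K).
Hypotheses (p_prime : prime p) (y1 : 1 < v y).
(** The exponent is [3 * p * p.-1], from the inverse of [theta], plus [2 * p.-1], from [rW ^+ p.-1]:
    the mixed terms of a [p]-th power are thus dominated by the linear term in the wild region. *)
Hypothesis (yp : v p%:R * v y ^+ ((3 * p + 2) * p.-1) < 1).
Implicit Types (c x z e w : K) (rho : R).

Local Notation b := (v y).
(* The wild region is the disk of radius [rW] about [0]: there [fam c] is
   approximated by [z ^ p + theta * z + c], and [rCrit] is the scale at which the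
   terms of degrees [p] and [1] have the same size. The point [omega], of norm
   [rOm > rW], is fixed by the whole family, and [fam c] multiplies distances by
   [rate] on the open disk of radius [rOm] about it. The exponents are chosen so
   that [rate * rCrit = kappa < 1], while [qexp] is prime to [p] and large enough
   for the correction term to be negligible in the wild region. *)
Definition omega : K := y ^+ 3.
Definition theta : K := (y ^+ (3 * p * p.-1))^-1.
Definition qexp : nat := (3 * p ^ 2).+1.
Definition rOm : R := b ^+ 3.
Definition rW : R := b ^+ 2.
Definition rCrit : R := (b ^+ (3 * p))^-1.
Definition rate : R := rOm ^+ p.-1.
Definition kappa : R := (b ^+ 3)^-1.

Definition wild_part c z := z ^+ p + theta * z + c.
(** A barycentre of [wild_part c z] and [omega]; the weight [(z / omega) ^+ qexp] of [omega] is tiny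
    in the wild region and equal to [1] at [omega]. *)
Definition fam c z := wild_part c z + (z / omega) ^+ qexp * (omega - wild_part c z).
Definition growth rho := Num.max (rho ^+ p) (v theta * rho).

Lemma b_gt0 : 0 < b. Proof. exact: lt_trans y1. Qed.
Hint Resolve b_gt0 : core.
Lemma bX_gt0 n : 0 < b ^+ n. Proof. exact: exprn_gt0. Qed.
Hint Resolve bX_gt0 : core.
Lemma p_gt1 : (1 < p)%N. Proof. exact: prime_gt1. Qed.
Hint Resolve p_gt1 : core.
Lemma bX_lt m n : (m < n)%N -> b ^+ m < b ^+ n.
Proof. by move=> h; rewrite ltr_eXn2l. Qed.
Lemma bX_le m n : (m <= n)%N -> b ^+ m <= b ^+ n.
Proof. by move=> h; rewrite ler_eXn2l. Qed.
Lemma bX_ge1 n : 1 <= b ^+ n. Proof. by rewrite exprn_ege1 // ltW. Qed.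
Lemma bX_gt1 n : (0 < n)%N -> 1 < b ^+ n.
Proof. by move=> h; rewrite exprn_egt1 // -lt0n. Qed.

Lemma v_omega : v omega = rOm. Proof. exact: unormX. Qed.
Lemma omega_neq0 : omega != 0. Proof. by rewrite -(unorm_gt0 v) v_omega; exact: bX_gt0. Qed.
Lemma rOm_gt1 : 1 < rOm. Proof. exact: bX_gt1. Qed.
Lemma rOm_gt0 : 0 < rOm. Proof. exact: bX_gt0. Qed.
Lemma rW_gt1 : 1 < rW. Proof. exact: bX_gt1. Qed.
Lemma rW_gt0 : 0 < rW. Proof. exact: bX_gt0. Qed.
Lemma rW_lt_rOm : rW < rOm. Proof. exact: bX_lt. Qed.
Lemma rCrit_gt0 : 0 < rCrit. Proof. by rewrite invr_gt0. Qed.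
Lemma rCrit_lt1 : rCrit < 1.
Proof. by rewrite invf_lt1 // bX_gt1 // muln_gt0 /= ltnW. Qed.
Lemma rate_gt1 : 1 < rate.
Proof. by rewrite exprn_egt1 ?rOm_gt1 // -lt0n -subn1 subn_gt0. Qed.
Lemma rate_gt0 : 0 < rate. Proof. exact: lt_trans rate_gt1. Qed.
Lemma rOm_le_rate : rOm <= rate.
Proof. by rewrite -[leLHS]expr1 ler_weXn2l ?(ltW rOm_gt1) // -subn1 subn_gt0. Qed.
Lemma kappa_gt0 : 0 < kappa. Proof. by rewrite invr_gt0. Qed.
Lemma kappa_lt1 : kappa < 1. Proof. by rewrite invf_lt1 // bX_gt1. Qed.
Lemma v_theta : v theta = rCrit ^+ p.-1.
Proof. by rewrite unormV unormX /rCrit exprVn -exprM. Qed.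
Lemma v_theta_gt0 : 0 < v theta. Proof. by rewrite v_theta exprn_gt0 // rCrit_gt0. Qed.
Lemma v_theta_lt1 : v theta < 1.
Proof. by rewrite v_theta exprn_ilt1 ?ltW ?rCrit_gt0 ?rCrit_lt1 // -lt0n -subn1 subn_gt0. Qed.
Lemma rate_rCrit : rate * rCrit = kappa.
Proof.
rewrite /rate /rCrit /kappa /rOm -exprM.
have -> : (3 * p = 3 * p.-1 + 3)%N by move: p_gt1; clear; lia.
by rewrite exprD invfM mulrA mulfV ?mul1r // gt_eqF.
Qed.
Lemma rCrit_le_kappa : rCrit <= kappa.
Proof. by rewrite -rate_rCrit ler_peMl ?(ltW rCrit_gt0) // ltW ?rate_gt1. Qed.

Lemma frob_coef_lt : v p%:R * rW ^+ p.-1 < v theta.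
Proof.
rewrite unormV unormX -[ltRHS]mul1r ltr_pdivlMr // -mulrA /rW -exprM -exprD.
by have -> : (2 * p.-1 + 3 * p * p.-1 = (3 * p + 2) * p.-1)%N by clear; lia.
Qed.

(** The left side is the Lipschitz constant of the correction term in the wild region. The size of
    [qexp] comes from here: [3 * p ^ 2] exceeds [2 * p + 3 * p * p.-1]. *)
Lemma pert_coef_lt : b^-1 ^+ (3 * p ^ 2) * b ^+ (2 * p) < v theta.
Proof.
rewrite unormV unormX exprVn mulrC ltr_pdivrMr // mulrC ltr_pdivlMr // -exprD.
by apply: bX_lt; move: p_gt1; clear; nia.
Qed.

Lemma v_divomega z : v (z / omega) = v z / rOm.
Proof. by rewrite unorm_div v_omega. Qed.

Lemma divomega_wild z : v z <= rW -> v (z / omega) <= b^-1.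
Proof.
move=> h; rewrite v_divomega ler_pdivrMr ?rOm_gt0 //; apply: le_trans h _.
by rewrite /rOm exprS mulKf // gt_eqF.
Qed.

Lemma wild_part_wild_le c z : v c <= 1 -> v z <= rW -> v (wild_part c z) <= b ^+ (2 * p).
Proof.
move=> c1 zB; have zp : v (z ^+ p) <= b ^+ (2 * p).
  by rewrite unormX exprM lerXn2r ?nnegrE ?unorm_ge0 // ltW ?rW_gt0.
apply: unormD_le; last exact: le_trans c1 (bX_ge1 _).
apply: unormD_le => //; rewrite unormM.
apply: (@le_trans _ _ (1 * rW)); first by rewrite ler_pM ?unorm_ge0 // ltW ?v_theta_lt1.
by rewrite mul1r; apply: bX_le; move: p_gt1; clear; lia.
Qed.

(** Product rule: the variation of the power is at most [b^-1 ^+ (3 * p ^ 2) * v e] and that of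
    [wild_part] at most [b ^+ (2 * p) * v e], while the other factors have the complementary
    bounds. *)
Lemma pert_wild_lip c x e : v c <= 1 -> v x <= rW -> v e <= 1 ->
  v ((x + e) / omega) <= b^-1 ->
  v (((x + e) / omega) ^+ qexp * (omega - wild_part c (x + e)) -
   (x / omega) ^+ qexp * (omega - wild_part c x))
    <= b^-1 ^+ (3 * p ^ 2) * b ^+ (2 * p) * v e.
Proof.
move=> c1 xB e1 xeb; have xb := divomega_wild xB.
have b1 : 0 <= b^-1 by rewrite invr_ge0 ltW.
have xeB : v (x + e) <= rW by apply: unormD_le => //; apply: le_trans e1 _; rewrite ltW ?rW_gt1.
set u' := (x + e) / omega; set u := x / omega.
have -> : u' ^+ qexp * (omega - wild_part c (x + e)) - u ^+ qexp * (omega - wild_part c x) =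
  (u' ^+ qexp - u ^+ qexp) * (omega - wild_part c (x + e)) +
  u ^+ qexp * (wild_part c x - wild_part c (x + e)) by ring.
apply: unormD_le; rewrite unormM.
  have h1 : v (u' ^+ qexp - u ^+ qexp) <= v e * b^-1 ^+ (3 * p ^ 2).
    apply: le_trans (unormXB_le _ xeb xb) _.
    rewrite ler_wpM2r ?exprn_ge0 // -mulrBl (addrC x) addrK v_divomega.
    by rewrite ler_pdivrMr ?rOm_gt0 // ler_peMr ?unorm_ge0 // ltW ?rOm_gt1.
  rewrite mulrAC (mulrC _ (v e)); apply: ler_pM; rewrite ?unorm_ge0 //.
  apply: unormB_le; last exact: wild_part_wild_le.
  by rewrite v_omega; apply: bX_le; move: p_gt1; clear; lia.
rewrite -mulrA; apply: ler_pM; rewrite ?unorm_ge0 //.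
  rewrite unormX exprS -[leRHS]mul1r ler_pM ?exprn_ge0 ?unorm_ge0 //.
    by rewrite (le_trans xb) // invf_le1 // ltW.
  by rewrite lerXn2r ?nnegrE ?unorm_ge0.
have -> : wild_part c x - wild_part c (x + e) = (x ^+ p - (x + e) ^+ p) - theta * e.
  by rewrite /wild_part; ring.
apply: unormB_le.
  have -> : p = p.-1.+1 by rewrite prednK // ltnW.
  apply: le_trans (unormXB_le _ xB xeB) _.
  rewrite opprD addNKr unormN mulrC ler_wpM2r ?unorm_ge0 // /rW -exprM /=.
  by apply: bX_le; clear; lia.
rewrite unormM ler_wpM2r ?unorm_ge0 // (le_trans (ltW v_theta_lt1)) //.
exact: bX_ge1.
Qed.

(** The error is strictly below the linear term, so that the model [e ^+ p + theta * e] decides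
    distances, except at the scale [rCrit], where its two terms may cancel. *)
Lemma fam_wild_err c x e : v c <= 1 -> v x <= rW -> v e <= 1 -> e != 0 ->
  v (fam c (x + e) - fam c x - (e ^+ p + theta * e)) < v theta * v e.
Proof.
move=> c1 xB e1 e0; have ve0 : 0 < v e by rewrite unorm_gt0.
have xeB : v (x + e) <= rW by apply: unormD_le => //; apply: le_trans e1 _; rewrite ltW ?rW_gt1.
have -> : fam c (x + e) - fam c x - (e ^+ p + theta * e) =
  ((x + e) ^+ p - x ^+ p - e ^+ p) +
  (((x + e) / omega) ^+ qexp * (omega - wild_part c (x + e)) -
   (x / omega) ^+ qexp * (omega - wild_part c x)).
  by rewrite /fam /wild_part; ring.
apply: unormD_lt.
  apply: le_lt_trans (unorm_exprD_prime p_prime _ xB e1) _; first by rewrite ltW ?rW_gt1.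
  by rewrite mulrA ltr_pM2r // frob_coef_lt.
apply: le_lt_trans (pert_wild_lip c1 xB e1 (divomega_wild xeB)) _.
by rewrite ltr_pM2r // pert_coef_lt.
Qed.

Lemma fam_wild_le c x x' : v c <= 1 -> v x <= rW -> v (x' - x) <= 1 ->
  v (fam c x' - fam c x) <= growth (v (x' - x)).
Proof.
move=> c1 xB e1; have [->|ne] := eqVneq x' x.
  by rewrite !subrr unorm0 le_max mulr0 lexx orbT.
set e := x' - x in e1 *; have e0 : e != 0 by rewrite subr_eq0.
have -> : x' = x + e by rewrite addrC subrK.
rewrite -[X in v X](subrK (e ^+ p + theta * e)); apply: unormD_le.
  by rewrite le_max (ltW (fam_wild_err c1 xB e1 e0)) orbT.
by rewrite /growth -unormX -unormM; exact: unormD.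
Qed.

Lemma theta_lt_pow r : rCrit < r -> v theta * r < r ^+ p.
Proof.
move=> h; have r0 : 0 < r := lt_trans rCrit_gt0 h.
have -> : r ^+ p = r ^+ p.-1 * r by rewrite -exprSr prednK // ltnW.
by rewrite ltr_pM2r // v_theta ltrXn2r ?nnegrE ?(ltW rCrit_gt0) // -?lt0n -?subn1 ?subn_gt0 // (ltW r0).
Qed.

Lemma pow_lt_theta r : 0 < r -> r < rCrit -> r ^+ p < v theta * r.
Proof.
move=> r0 h; have -> : r ^+ p = r ^+ p.-1 * r by rewrite -exprSr prednK // ltnW.
by rewrite ltr_pM2r // v_theta ltrXn2r ?nnegrE ?(ltW rCrit_gt0) // -?lt0n -?subn1 ?subn_gt0 // (ltW r0).
Qed.

Lemma fam_wild_pow c x x' : v c <= 1 -> v x <= rW -> rCrit < v (x' - x) -> v (x' - x) <= 1 ->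
  v (fam c x' - fam c x) = v (x' - x) ^+ p.
Proof.
move=> c1 xB e2 e1; set e := x' - x in e1 e2 *.
have e0 : e != 0 by rewrite -(unorm_gt0 v); apply: lt_trans e2; exact: rCrit_gt0.
have -> : x' = x + e by rewrite addrC subrK.
have h := theta_lt_pow e2.
have he : v (e ^+ p + theta * e) = v e ^+ p by rewrite unormDl ?unormX // unormM.
rewrite -[X in v X](subrK (e ^+ p + theta * e)) unormDr // he.
exact: lt_trans (fam_wild_err c1 xB e1 e0) h.
Qed.

Lemma fam_wild_lin c x x' : v c <= 1 -> v x <= rW -> v (x' - x) < rCrit ->
  v (fam c x' - fam c x) = v theta * v (x' - x).
Proof.
move=> c1 xB e2; have [->|ne] := eqVneq x' x; first by rewrite !subrr unorm0 mulr0.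
set e := x' - x in e2 *.
have e1 : v e <= 1 by rewrite (le_trans (ltW e2)) // ltW // rCrit_lt1.
have e0 : e != 0 by rewrite subr_eq0.
have ve0 : 0 < v e by rewrite unorm_gt0.
have -> : x' = x + e by rewrite addrC subrK.
have h := pow_lt_theta ve0 e2.
have he : v (e ^+ p + theta * e) = v theta * v e by rewrite unormDr ?unormM // unormX.
by rewrite -[X in v X](subrK (e ^+ p + theta * e)) unormDr // he fam_wild_err.
Qed.

Lemma fam_param c c' z : fam c z - fam c' z = (c - c') * (1 - (z / omega) ^+ qexp).
Proof. by rewrite /fam /wild_part; ring. Qed.

Lemma fam_param_wild c c' z : v z <= rW -> v (fam c z - fam c' z) = v (c - c').
Proof.
move=> zB; rewrite fam_param unormM (@unormBl _ _ v 1) unorm1 ?mulr1 // unormX.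
rewrite exprn_ilt1 ?unorm_ge0 //.
by rewrite (le_lt_trans (divomega_wild zB)) // invf_lt1.
Qed.

Lemma fam_omega c : fam c omega = omega.
Proof. by rewrite /fam mulfV ?omega_neq0 // expr1n mul1r addrC subrK. Qed.

Lemma divomega_near z : v (z - omega) < rOm -> v (z / omega - 1) < 1.
Proof.
move=> h; rewrite -(mulfV omega_neq0) -mulrBl v_divomega.
by rewrite ltr_pdivrMr ?rOm_gt0 ?mul1r.
Qed.

Lemma v_near z : v (z - omega) < rOm -> v z = rOm.
Proof. by move=> h; rewrite -(subrK omega z) unormDr v_omega. Qed.

Lemma unormX_sub1_lt u n : v (u - 1) < 1 -> v (u ^+ n - 1) < 1.
Proof.
move=> h; have u1 : v u <= 1.
  by rewrite -(subrK 1 u); apply: unormD_le; rewrite ?unorm1 // ltW.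
case: n => [|n]; first by rewrite expr0 subrr unorm0.
rewrite -(expr1n K n.+1); apply: le_lt_trans (unormXB_le _ u1 _) _.
  by rewrite unorm1.
by rewrite expr1n mulr1.
Qed.

(** [qexp] is congruent to [1] modulo [p], hence a unit of the valuation ring. *)
Lemma v_qexp : v qexp%:R = 1.
Proof.
rewrite /qexp -natr1 unormDr unorm1 // natrM natrX unormM.
have p1 : v p%:R < 1.
  apply: le_lt_trans yp; rewrite ler_peMr ?unorm_ge0 //; exact: bX_ge1.
apply: le_lt_trans (_ : v (p%:R ^+ 2) < 1).
  by rewrite ler_piMl ?unorm_ge0 ?unorm_nat_le1.
by rewrite unormX exprn_ilt1 ?unorm_ge0.
Qed.

(** In the factorization of a difference of powers, the cofactor of [u - u'] is congruent to the
    unit [qexp] modulo the maximal ideal. *)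
Lemma unormXB_near1 u u' : v (u - 1) < 1 -> v (u' - 1) < 1 ->
  v (u ^+ qexp - u' ^+ qexp) = v (u - u').
Proof.
move=> hu hu'; rewrite subrXX unormM; set S := \sum_(i < _) _.
suff -> : v S = 1 by rewrite mulr1.
have <- : v (S - qexp%:R + qexp%:R) = 1; last by rewrite subrK.
rewrite unormDr ?v_qexp //.
have -> : S - qexp%:R = \sum_(i < qexp) (u ^+ (qexp.-1 - i) * u' ^+ i - 1).
  by rewrite sumrB; congr (_ - _); rewrite sumr_const card_ord.
pose m := \big[Num.max/0]_(i < qexp) v (u ^+ (qexp.-1 - i) * u' ^+ i - 1).
have m1 : m < 1.
  rewrite /m; elim/big_ind : _ => [|s t s1 t1|i _] //; first by rewrite gt_max s1.
  have -> : u ^+ (qexp.-1 - i) * u' ^+ i - 1 =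
    (u ^+ (qexp.-1 - i) - 1) * u' ^+ i + (u' ^+ i - 1) by ring.
  apply: unormD_lt; last exact: unormX_sub1_lt.
  have hh := unormX_sub1_lt i hu'.
  have -> : v ((u ^+ (qexp.-1 - i) - 1) * u' ^+ i) = v (u ^+ (qexp.-1 - i) - 1).
    have h1 : v (u' ^+ i) = 1 by rewrite -(subrK 1 (u' ^+ i)) unormDr unorm1.
    by rewrite unormM h1 mulr1.
  exact: unormX_sub1_lt.
apply: le_lt_trans m1; apply: unorm_sum_le.
  by rewrite /m; elim/big_ind : _ => // [s t s0 t0|i _]; rewrite ?le_max ?s0 ?unorm_ge0.
by move=> i _; rewrite /m; apply: le_bigmax.
Qed.

Lemma wild_part_near c z : v c <= 1 -> v z = rOm -> v (wild_part c z - omega) = rOm ^+ p.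
Proof.
move=> c1 zT; have T1 := rOm_gt1.
have TT : rOm < rOm ^+ p by rewrite -[ltLHS]expr1 ltr_eXn2l.
have -> : wild_part c z - omega = z ^+ p + (theta * z + c - omega) by rewrite /wild_part; ring.
rewrite unormDl unormX zT //; apply: le_lt_trans TT.
apply: unormB_le; last by rewrite v_omega.
apply: unormD_le; last exact: le_trans c1 (ltW T1).
by rewrite unormM zT ler_piMl ?(ltW rOm_gt0) // ltW ?v_theta_lt1.
Qed.

(** The variation of the power gives the dominant term, since [wild_part c z - omega] has norm
    [rOm ^+ p]; the variation of [wild_part] is weighted by [1 - (z' / omega) ^+ qexp], of norm less
    than [1]. *)
Lemma fam_near c z z' : v c <= 1 -> v (z - omega) < rOm -> v (z' - omega) < rOm ->
  v (fam c z - fam c z') = rate * v (z - z').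
Proof.
move=> c1 hz hz'; have [->|ne] := eqVneq z z'; first by rewrite !subrr unorm0 mulr0.
have vz := v_near hz; have vz' := v_near hz'.
have ve0 : 0 < v (z - z') by rewrite unorm_gt0 subr_eq0.
have T0 := rOm_gt0.
set u := z / omega; set u' := z' / omega.
have -> : fam c z - fam c z' = (wild_part c z - omega) * (u' ^+ qexp - u ^+ qexp) +
   (wild_part c z - wild_part c z') * (1 - u' ^+ qexp) by rewrite /fam -/u -/u'; ring.
have hu := divomega_near hz; have hu' := divomega_near hz'.
have h1 : v ((wild_part c z - omega) * (u' ^+ qexp - u ^+ qexp)) = rate * v (z - z').
  rewrite unormM wild_part_near // unormXB_near1 // /u /u' -mulrBl v_divomega unorm_distC.
  have -> : rOm ^+ p = rate * rOm by rewrite /rate -exprSr prednK // ltnW.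
  by rewrite -mulrA [rOm * _]mulrC divfK // gt_eqF.
have h2 : v (1 - u' ^+ qexp) < 1 by rewrite unorm_distC; exact: unormX_sub1_lt.
have h3 : v (wild_part c z - wild_part c z') <= rate * v (z - z').
  have -> : wild_part c z - wild_part c z' = (z ^+ p - z' ^+ p) + theta * (z - z').
    by rewrite /wild_part; ring.
  apply: unormD_le.
    have {1 2}-> : p = p.-1.+1 by rewrite prednK // ltnW.
    by rewrite mulrC; apply: unormXB_le; rewrite ?vz ?vz'.
  by rewrite unormM ler_wpM2r ?unorm_ge0 // ltW // (lt_trans v_theta_lt1) // rate_gt1.
have h4 : v ((wild_part c z - wild_part c z') * (1 - u' ^+ qexp)) < rate * v (z - z').
  rewrite unormM; apply: le_lt_trans (_ : rate * v (z - z') * v (1 - u' ^+ qexp) < _).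
    apply: ler_wpM2r h3; exact: unorm_ge0.
  by rewrite gtr_pMr // mulr_gt0 ?rate_gt0.
by rewrite unormDl h1.
Qed.

Lemma fam_near_omega c z : v c <= 1 -> v (z - omega) < rOm ->
  v (fam c z - omega) = rate * v (z - omega).
Proof.
by move=> c1 hz; rewrite -{1}(fam_omega c) fam_near // subrr unorm0 rOm_gt0.
Qed.

Lemma fam_param_near c c' z : v (z - omega) < rOm -> c != c' -> v (fam c z - fam c' z) < v (c - c').
Proof.
move=> hz ne; rewrite fam_param unormM gtr_pMr ?unorm_gt0 ?subr_eq0 // unorm_distC.
exact/unormX_sub1_lt/divomega_near.
Qed.

(** Beyond [rOm] the term [z ^+ p] dominates [wild_part] and the correction term dominates [fam]. *)
Lemma fam_escape c z : v c <= 1 -> rOm < v z -> b * v z <= v (fam c z).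
Proof.
move=> c1 hz; have T1 := rOm_gt1; have T0 := rOm_gt0.
have z1 : 1 < v z := lt_trans T1 hz.
have z0 : 0 < v z by apply: lt_trans z1.
have zz : v z < v z ^+ p by rewrite -[ltLHS]expr1 ltr_eXn2l.
have hf : v (wild_part c z) = v z ^+ p.
  rewrite /wild_part -addrA unormDl unormX //; apply: le_lt_trans zz.
  apply: unormD_le; last by rewrite (le_trans c1) // ltW.
  by rewrite unormM ler_piMl ?unorm_ge0 // ltW ?v_theta_lt1.
have hf' : v (omega - wild_part c z) = v z ^+ p.
  by rewrite unormBr hf // v_omega (lt_trans hz).
have hu : 1 < v (z / omega) by rewrite v_divomega ltr_pdivlMr ?mul1r.
have hu' : 1 < v (z / omega) ^+ qexp by rewrite exprn_egt1.
have -> : v (fam c z) = v (z / omega) ^+ qexp * v z ^+ p.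
  rewrite /fam unormDr unormM unormX hf' // hf.
  by rewrite ltr_pMl // exprn_gt0.
rewrite (@le_trans _ _ (v z ^+ p)) //; last by rewrite ler_peMl ?exprn_ge0 ?unorm_ge0 // ltW.
rewrite (@le_trans _ _ (v z ^+ 2)) ?ler_eXn2l //.
rewrite expr2 ler_pM2r // (le_trans _ (ltW hz)) // /rOm -[leLHS]expr1.
exact: bX_le.
Qed.

Definition fam_poly c : {poly K} :=
  let f := 'X^p + theta *: 'X + c%:P in f + omega^-1 ^+ qexp *: ('X^qexp * (omega%:P - f)).

Lemma fam_polyE c z : (fam_poly c).[z] = fam c z.
Proof.
rewrite /fam_poly /fam /wild_part; move: qexp => q.
by rewrite !hornerE exprMn /= [z ^+ q * _]mulrC.
Qed.

Lemma fam_poly_size c : (2 < size (fam_poly c))%N.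
Proof.
have p1 := p_gt1.
(* This coefficient, coming from the product of ['X^qexp] and ['X^p], is the opposite of
   [omega^-1 ^+ qexp]. *)
suff : (fam_poly c)`_(qexp + p) != 0.
  apply: contraNltn => h; apply/eqP; apply: nth_default.
  by rewrite (leq_trans h) // /qexp; move: p1; clear; lia.
rewrite /fam_poly !(coefD, coefZ, coefXn, coefX, coefC, coefXnM, coefB).
rewrite ltnNge leq_addr /= addKn !(coefN, coefD, coefZ, coefXn, coefX, coefC) eqxx.
have -> : ((qexp + p)%N == p) = false by rewrite /qexp; move: p1; clear; lia.
have -> : ((qexp + p)%N == 1%N) = false by rewrite /qexp; move: p1; clear; lia.
have -> : (p == 0)%N = false by move: p1; clear; lia.
have -> : (p == 1)%N = false by move: p1; clear; lia.
rewrite !mulr0 !addr0 !add0r mulrN1 oppr_eq0.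
by rewrite expf_neq0 // invr_eq0 omega_neq0.
Qed.

(** At [y ^+ 2], of norm [rW], the term [z ^+ p] dominates; hence the disk of radius [rW] covers a
    disk of radius [rW ^+ p], which is at least [rOm]. *)
Lemma fam_wild_preim c w : v c <= 1 -> v w <= rOm -> exists2 z, v z <= rW & fam c z = w.
Proof.
move=> c1 wT; have p1 := p_gt1.
have F0 : fam c 0 = c.
  have e0 : 0 ^+ p = 0 :> K by rewrite expr0n gtn_eqF // ltnW.
  by rewrite /fam /wild_part e0 mul0r expr0n /= mul0r mulr0 !add0r addr0.
have vz : v (y ^+ 2) = rW by exact: unormX.
have [|z] := @exists_preimage_near _ _ v (fam_poly c) (y ^+ 2) 0 w.
  rewrite !fam_polyE F0; set z := y ^+ 2 in vz *.
  have hp : v (z ^+ p) = b ^+ (2 * p) by rewrite unormX vz exprM.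
  have -> : fam c z - c = z ^+ p + (theta * z + (z / omega) ^+ qexp * (omega - wild_part c z)).
    by rewrite /fam /wild_part; ring.
  rewrite [leRHS]unormDl hp; last first.
    apply: unormD_lt; rewrite unormM.
      apply: lt_le_trans (_ : rW <= _); last by apply: bX_le; move: p_gt1; clear; lia.
      by rewrite vz gtr_pMl ?rW_gt0 ?v_theta_lt1.
    have hu : v ((z / omega) ^+ qexp) < 1.
      rewrite unormX exprn_ilt1 ?unorm_ge0 //.
      by rewrite (le_lt_trans (divomega_wild _)) ?vz // invf_lt1.
    apply: le_lt_trans (_ : v ((z / omega) ^+ qexp) * b ^+ (2 * p) < _).
      rewrite ler_wpM2l ?unorm_ge0 //; apply: unormB_le; last by apply: wild_part_wild_le; rewrite ?vz.
      by rewrite v_omega; apply: bX_le; move: p_gt1; clear; lia.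
    by rewrite gtr_pMl.
  apply: (@le_trans _ _ rOm); last by apply: bX_le; move: p_gt1; clear; lia.
  by apply: unormB_le => //; rewrite (le_trans c1) // ltW ?rOm_gt1.
by rewrite !subr0 vz fam_polyE => zB zw; exists z.
Qed.

(** * Choice of the parameter *)

Hypothesis v_nontrivial : nontrivial_norm v.

Let T0 : 0 < rOm := rOm_gt0.
Let T1 : 1 < rOm := rOm_gt1.
Let L1 : 1 < rate := rate_gt1.
Let L0 : 0 < rate := rate_gt0.
Let k0 : 0 < kappa := kappa_gt0.
Let k1 : kappa < 1 := kappa_lt1.
Let d0 : 0 < rCrit := rCrit_gt0.
Let d1 : rCrit < 1 := rCrit_lt1.
Let BT : rW < rOm := rW_lt_rOm.
Let B1 : 1 < rW := rW_gt1.

Lemma growth_gt0 rho : 0 < rho -> 0 < growth rho.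
Proof. by move=> h; rewrite /growth lt_max exprn_gt0. Qed.

Lemma growth_mono rho rho' : 0 <= rho -> rho <= rho' -> growth rho <= growth rho'.
Proof.
move=> h0 h; rewrite /growth ge_max !le_max lerXn2r ?nnegrE //=; last exact: le_trans h.
by rewrite ler_wpM2l ?orbT ?unorm_ge0.
Qed.

Lemma growth_le1 rho : 0 <= rho -> rho <= 1 -> growth rho <= 1.
Proof.
move=> h0 h; rewrite /growth ge_max exprn_ile1 //= mulr_ile1 ?unorm_ge0 // ltW //.
exact: v_theta_lt1.
Qed.

Lemma growth_contract rho : 0 <= rho -> rho <= kappa -> growth rho <= kappa * rho.
Proof.
move=> h0 h; have p1 := p_gt1; rewrite /growth ge_max; apply/andP; split.
  have -> : rho ^+ p = rho ^+ p.-1 * rho by rewrite -exprSr prednK // ltnW.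
  rewrite ler_wpM2r // (le_trans _ h) // -[leRHS]expr1.
  by rewrite ler_wiXn2l ?(le_trans h) ?(ltW k1) // -subn1 subn_gt0.
rewrite ler_wpM2r // (le_trans _ (rCrit_le_kappa)) // v_theta.
by rewrite -[leRHS]expr1 ler_wiXn2l ?ltW // -subn1 subn_gt0.
Qed.

Lemma near_iter c z n : v c <= 1 -> rate ^+ n * v (z - omega) <= rOm ->
  forall j, (j <= n)%N -> v (iter j (fam c) z - omega) = rate ^+ j * v (z - omega).
Proof.
move=> c1 h; elim=> [|j ih] hj; first by rewrite expr0 mul1r.
rewrite iterS fam_near_omega // ih ?(ltnW hj) // ?exprS ?mulrA //.
rewrite -(ltr_pM2l L0) mulrA -exprS.
apply: le_lt_trans (_ : rate ^+ n * v (z - omega) < _).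
  by rewrite ler_wpM2r ?unorm_ge0 // ler_weXn2l // ltW.
by apply: le_lt_trans h _; rewrite ltr_pMl.
Qed.

Variables (x0 : K) (r : R).

Definition orb c n := iter n (fam c) x0.

Lemma orbS c n : orb c n.+1 = fam c (orb c n). Proof. by []. Qed.

Fixpoint orbp n : {poly K} :=
  if n is m.+1 then
    let x := orbp m in let f := x ^+ p + theta *: x + 'X in
    f + omega^-1 ^+ qexp *: (x ^+ qexp * (omega%:P - f))
  else x0%:P.

Lemma orbpE c n : (orbp n).[c] = orb c n.
Proof.
elim: n => [|n ih]; first by rewrite hornerC.
rewrite orbS /= /fam /wild_part; move: qexp => q.
by rewrite !hornerE ih exprMn /= [orb c n ^+ q * _]mulrC.
Qed.

(* As long as the orbit is admissible, the [n]-th iterate maps the disk of radius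
   [r] about [x0] into the disk of radius [rad c n] about [orb c n]. *)
Fixpoint rad c n : R :=
  if n is m.+1 then
    if v (orb c m) <= rW then growth (rad c m) else rate * rad c m
  else r.

Definition admissible c n :=
  (v (orb c n) <= rW \/ v (orb c n - omega) < rOm) /\ 0 < rad c n < kappa.

Lemma wild_diff c c' x x' : v c <= 1 -> v x <= rW -> v (x' - x) <= 1 ->
  v (fam c' x' - fam c x) <= Num.max (growth (v (x' - x))) (v (c' - c)).
Proof.
move=> c1 xB e1; have xB' : v x' <= rW.
  by rewrite -(subrK x x'); apply: unormD_le => //; rewrite (le_trans e1) // ltW.
have -> : fam c' x' - fam c x = (fam c x' - fam c x) + (fam c' x' - fam c x') by ring.
apply: le_trans (unormD _ _ _) _.
rewrite ge_max; apply/andP; split.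
  by apply: le_trans (fam_wild_le c1 xB e1) _; rewrite le_max lexx.
by rewrite (fam_param_wild) // le_max lexx orbT.
Qed.

(** At time [s] the orbit varies at most [E] times as fast as the parameter. A wild step contracts
    earlier differences by [kappa] and adds the direct effect of the parameter, an exact isometry;
    after [m] steps the inherited part is no longer amplified, and one more step makes it strictly
    smaller than the direct effect. *)
Lemma wild_stage c1 s m E eta : v c1 < 1 -> 0 <= E -> 0 < eta -> eta <= kappa ->
  E * eta <= kappa -> kappa ^+ m * E <= 1 ->
  (forall i, (i <= m)%N -> v (orb c1 (s + i)) <= rW) ->
  (forall c c', v (c - c1) < eta -> v (c' - c1) < eta ->
     v (orb c' s - orb c s) <= E * v (c' - c)) ->
  (forall c i, v (c - c1) < eta -> (i <= m)%N -> v (orb c (s + i)) <= rW) /\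
  (forall c c', v (c - c1) < eta -> v (c' - c1) < eta ->
     v (orb c' (s + m.+1) - orb c (s + m.+1)) = v (c' - c)).
Proof.
move=> c11 E0 eta0 etak Ek mE W H.
have c1D : v (c1 - c1) < eta by rewrite subrr unorm0.
have D1 c : v (c - c1) < eta -> v c <= 1.
  move=> h; rewrite -(subrK c1 c); apply: unormD_le; rewrite ltW //.
  by apply: lt_trans h _; apply: le_lt_trans k1.
have Dd c c' : v (c - c1) < eta -> v (c' - c1) < eta -> v (c' - c) < eta.
  by move=> h h'; apply: unorm_dist_lt h' _; rewrite unorm_distC.
(* [M i] is a Lipschitz constant, with respect to the parameter, for the orbit at time [s + i]. *)
pose M i := Num.max (kappa ^+ i * E) 1.
have M0 i : 0 <= M i by rewrite le_max ler01 orbT.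
have Mk i t : 0 <= t -> t < eta -> M i * t <= kappa.
  move=> t0 ht; rewrite maxr_pMl // ge_max mul1r (le_trans (ltW ht)) // andbT.
  rewrite (le_trans _ Ek) //; apply: (@le_trans _ _ (E * t)).
    by rewrite -mulrA ler_piMl ?mulr_ge0 // exprn_ile1 // ltW.
  by rewrite ler_wpM2l // ltW.
have key i : (i <= m.+1)%N ->
   (forall c j, v (c - c1) < eta -> (j < i)%N -> v (orb c (s + j)) <= rW) /\
   forall c c', v (c - c1) < eta -> v (c' - c1) < eta ->
     v (orb c' (s + i) - orb c (s + i)) <= M i * v (c' - c).
  elim: i => [|i ih] hi.
    split=> // c c' h h'; rewrite !addn0 (le_trans (H _ _ h h')) // ler_wpM2r ?unorm_ge0 //.
    by rewrite /M expr0 mul1r le_max lexx.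
  have [iW iM] := ih (ltnW hi).
  have Wi c : v (c - c1) < eta -> v (orb c (s + i)) <= rW.
    move=> h; rewrite -(subrK (orb c1 (s + i)) (orb c _)); apply: unormD_le; last exact: W.
    rewrite (le_trans (iM _ _ c1D h)) // (le_trans (Mk i _ _ h)) ?unorm_ge0 // ltW //.
    exact: lt_trans B1.
  split=> [c j h|c c' h h'].
    by rewrite ltnS leq_eqVlt => /orP[/eqP->|hj]; [exact: Wi|exact: iW].
  have hMk : M i * v (c' - c) <= kappa by exact: (Mk _ _ (unorm_ge0 _ _) (Dd _ _ h h')).
  have e1 : v (orb c' (s + i) - orb c (s + i)) <= kappa.
    exact: le_trans (iM _ _ h h') _.
  have e2 : v (orb c' (s + i) - orb c (s + i)) <= 1 by rewrite (le_trans e1) // ltW.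
  rewrite addnS !orbS; apply: le_trans (wild_diff _ (D1 _ h) (Wi _ h) e2) _.
  rewrite ge_max; apply/andP; split; last first.
    by rewrite ler_peMl ?unorm_ge0 // le_max lexx orbT.
  apply: le_trans (growth_contract (unorm_ge0 _ _) e1) _.
  apply: le_trans (_ : kappa * (M i * v (c' - c)) <= _).
    by rewrite ler_pM2l // iM.
  rewrite mulrA ler_wpM2r ?unorm_ge0 // /M maxr_pMr ?(ltW k0) // mulr1 mulrA -exprS.
  by rewrite ge_max !le_max lexx (ltW k1) orbT.
have [kW kM] := key m (leqnSn m); have [kW' _] := key m.+1 (leqnn _).
split=> [c i h hi|c c' h h']; first exact: kW'.
have [->|ne] := eqVneq c' c; first by rewrite !subrr.
have vd : 0 < v (c' - c) by rewrite unorm_gt0 subr_eq0.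
have e1 : v (orb c' (s + m) - orb c (s + m)) <= v (c' - c).
  by rewrite (le_trans (kM _ _ h h')) // /M max_r // mul1r.
have e2 : v (c' - c) <= kappa by rewrite (le_trans _ etak) // ltW // Dd.
have e3 : v (orb c' (s + m) - orb c (s + m)) <= kappa by exact: le_trans e2.
rewrite addnS !orbS -(subrK (fam c (orb c' (s + m))) (fam c' _)) -addrA.
have e4 : v (orb c' (s + m) - orb c (s + m)) <= 1 by rewrite (le_trans e3) // ltW.
rewrite unormDl (fam_param_wild _ _ (kW' _ _ h' (ltnSn _))) //.
apply: le_lt_trans (fam_wild_le (D1 _ h) (kW' _ _ h (ltnSn _)) e4) _.
apply: le_lt_trans (growth_contract (unorm_ge0 _ _) e3) _.
apply: le_lt_trans (_ : kappa * v (c' - c) < _); first by rewrite ler_pM2l.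
by rewrite gtr_pMl.
Qed.

Lemma rad_wild c s m rho : rad c s = rho -> (forall i, (i < m)%N -> v (orb c (s + i)) <= rW) ->
  forall i, (i <= m)%N -> rad c (s + i) = iter i growth rho.
Proof.
move=> h W; elim=> [|i ih] hi; first by rewrite addn0.
by rewrite addnS /= W // ih // ltnW.
Qed.

Lemma iter_growth_bounds rho i : 0 < rho -> rho < kappa ->
  0 < iter i growth rho /\ iter i growth rho <= kappa ^+ i * rho.
Proof.
move=> h0 hk; elim: i => [|i [ih1 ih2]]; first by rewrite expr0 mul1r.
split; first exact: growth_gt0.
have hi : iter i growth rho <= kappa.
  by rewrite (le_trans ih2) // (le_trans _ (ltW hk)) // ler_piMl ?(ltW h0) // exprn_ile1 // ltW.
rewrite iterS (le_trans (growth_contract (ltW ih1) hi)) // exprS -mulrA.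
by rewrite ler_pM2l.
Qed.

Lemma near_stage c N n : v c <= 1 -> rate ^+ n * v (orb c N - omega) <= rOm ->
  forall j, (j <= n)%N -> v (orb c (N + j) - omega) = rate ^+ j * v (orb c N - omega).
Proof. by move=> c1 h j hj; rewrite addnC /orb iterD; exact: (near_iter c1 h hj). Qed.

Lemma near_stage_lt c N n : v c <= 1 -> rate ^+ n * v (orb c N - omega) <= rOm ->
  forall j, (j < n)%N -> v (orb c (N + j) - omega) < rOm.
Proof.
move=> c1 h j hj; rewrite (near_stage c1 h (ltnW hj)) -(ltr_pM2l L0) mulrA -exprS.
apply: le_lt_trans (_ : rate ^+ n * v (orb c N - omega) < _).
  by rewrite ler_wpM2r ?unorm_ge0 // ler_weXn2l // ltW.
by apply: le_lt_trans h _; rewrite ltr_pMl.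
Qed.

(** The expansion of the existing difference by [rate] prevails over the direct effect of the
    parameter, which is less than [v (c' - c)] near [omega]. *)
Lemma near_stage_diff c c' N n : v c <= 1 -> v c' <= 1 ->
  rate ^+ n * v (orb c N - omega) <= rOm -> rate ^+ n * v (orb c' N - omega) <= rOm ->
  v (orb c' N - orb c N) = v (c' - c) ->
  forall j, (j <= n)%N -> v (orb c' (N + j) - orb c (N + j)) = rate ^+ j * v (c' - c).
Proof.
move=> c1 c1' h h' hN; have [->|ne] := eqVneq c' c.
  by move=> j _; rewrite !subrr unorm0 mulr0.
have vd : 0 < v (c' - c) by rewrite unorm_gt0 subr_eq0.
elim=> [|j ih] hj; first by rewrite !addn0 expr0 mul1r.
have n1 := near_stage_lt c1 h hj; have n2 := near_stage_lt c1' h' hj.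
rewrite addnS !orbS -(subrK (fam c (orb c' (N + j))) (fam c' _)) -addrA.
have e : v (fam c (orb c' (N + j)) - fam c (orb c (N + j))) = rate ^+ j.+1 * v (c' - c).
  by rewrite fam_near // ih ?(ltnW hj) // exprS mulrA.
rewrite unormDr e //; apply: lt_le_trans (fam_param_near n2 ne) _.
by rewrite ler_peMl ?unorm_ge0 // exprn_ege1 // ltW.
Qed.

Lemma rad_near c N n rho : v c <= 1 -> rate ^+ n * v (orb c N - omega) <= rOm -> rad c N = rho ->
  forall j, (j <= n)%N -> rad c (N + j) = rate ^+ j * rho.
Proof.
move=> c1 h hr; elim=> [|j ih] hj; first by rewrite addn0 expr0 mul1r.
rewrite addnS /= (v_near (near_stage_lt c1 h hj)) leNgt BT /= ih ?(ltnW hj) //.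
by rewrite exprS mulrA.
Qed.

Lemma kappa_pow_small t : 0 < t -> exists m, kappa ^+ m < t.
Proof.
move=> t0; have k1' : 1 < kappa^-1 by rewrite invf_gt1.
have [m hm] := exprn_unbounded t^-1 k1'; exists m.
by rewrite -[t]invrK -[ltLHS]invrK -exprVn ltf_pV2 // posrE ?exprn_gt0 ?invr_gt0.
Qed.

Definition similar_disk c0 eta N := forall c c', v (c - c0) < eta -> v (c' - c0) < eta ->
  v (orb c' N - orb c N) = v (c' - c).

(* The orbit of [x0] under [fam c0] falls on the repelling fixed point at time
   [N]. For all parameters of the disk of radius [eta], the orbits share their
   itinerary up to then, and their points at time [N] move as the parameter does. *)
Record landing (c0 : K) (N : nat) (eta rho : R) : Prop := Landing {
  landing_c : v c0 < 1;
  landing_eta : 0 < eta <= 1;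
  landing_omega : orb c0 N = omega;
  landing_adm : forall c n, v (c - c0) < eta -> (n < N)%N -> admissible c n;
  landing_rad : forall c, v (c - c0) < eta -> rad c N = rho;
  landing_iso : similar_disk c0 eta N;
  landing_rho : 0 < rho /\ rho * rOm < rCrit * eta }.

(** * Parameters whose orbit passes through a prescribed point *)

Section Covering.
Variables (c0 : K) (N n : nat) (eta : R).
(** Differences of parameters of norm [eta'] become differences of orbits of norm [rOm] after [n]
    steps near [omega]. *)
Let eta' := rOm / rate ^+ n.
Hypotheses (c01 : v c0 < 1) (eta1 : eta <= 1) (eta'_lt : eta' < eta).
Hypotheses (orb_omega : orb c0 N = omega) (iso : similar_disk c0 eta N).

Let Ln0 : 0 < rate ^+ n. Proof. exact: exprn_gt0. Qed.

Lemma disk_le1 c : v (c - c0) <= eta' -> v c <= 1.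
Proof.
move=> h; rewrite -(subrK c0 c); apply: unormD_le; last exact: ltW.
by rewrite (le_trans h) // (le_trans (ltW eta'_lt)).
Qed.

Lemma disk_near c : v (c - c0) <= eta' -> rate ^+ n * v (orb c N - omega) <= rOm.
Proof.
move=> h; rewrite -orb_omega iso ?subrr ?unorm0 //.
- by rewrite mulrC -ler_pdivlMr.
- by apply: lt_trans eta'_lt; rewrite divr_gt0.
- exact: le_lt_trans eta'_lt.
Qed.

Lemma disk_orb_diff c c' : v (c - c0) <= eta' -> v (c' - c0) <= eta' ->
  forall j, (j <= n)%N -> v (orb c' (N + j) - orb c (N + j)) = rate ^+ j * v (c' - c).
Proof.
move=> h h'; apply: near_stage_diff; rewrite ?disk_le1 ?disk_near //.
by apply: iso; apply: le_lt_trans eta'_lt.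
Qed.

Let s := (N + n)%N.

Lemma orb_omega_add j : orb c0 (N + j) = omega.
Proof. by elim: j => [|j ih]; rewrite ?addn0 // addnS orbS ih (fam_omega). Qed.

(* An approximate solution [c'] of the equation [orb c _ = w] is corrected into an
   exact one by a variation [h] of the parameter for which the orbits separate,
   at the beginning of the wild stage, by a distance so close to [1] that its
   iterated [p]-th powers remain greater than the error [eta']. *)
Lemma cover_correct c' j w : v (c' - c0) <= eta' ->
  (forall i, (i <= j)%N -> v (orb c' (s + i)) <= rW) ->
  v (orb c' (s + j.+1) - w) <= eta' ->
  exists c, [/\ v (c - c0) <= eta', orb c (s + j.+1) = w &
    forall i, (i <= j)%N -> v (orb c (s + i)) <= rW].
Proof.
move=> hc' W hw; have p1 := p_gt1.
have e'1 : eta' < 1 by apply: lt_le_trans eta'_lt _.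
pose P := (p ^ j.+1)%N.
have P0 : (0 < P)%N by rewrite expn_gt0 ltnW.
(* [v z'] will be the final separation: above [rCrit], so that the [p]-th power governs every step,
   and above [eta'], so that the error is covered. *)
have [z' /andP[z'1 z'2]] : exists z', Num.max rCrit eta' < v z' < 1.
  by apply: exists_unorm_between; rewrite // gt_max d1.
have [z zP] := @exists_nth_root K z' P P0.
have vz' : v z' = v z ^+ P by rewrite -zP unormX.
have z1 : v z < 1.
  by rewrite ltNge; apply/negP => h; move: z'2; rewrite vz' ltNge exprn_ege1.
have zi i : (i <= j.+1)%N -> v z' <= v z ^+ (p ^ i).
  move=> hi; rewrite vz' ler_wiXn2l ?unorm_ge0 ?(ltW z1) //.
  by rewrite leq_exp2l.
(* The [n] steps near [omega] expand this variation to a separation of exactly [v z] at time [s]. *)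
pose h := z / omega ^+ (p.-1 * n).
have vL : v (omega ^+ (p.-1 * n)) = rate ^+ n by rewrite unormX v_omega exprM.
have vh : v h = v z / rate ^+ n by rewrite unorm_div vL.
have he' : v h <= eta'.
  by rewrite vh ler_pM2r ?invr_gt0 // (le_trans (ltW z1)) // ltW.
pose c'' := c' + h.
have dc : c'' - c' = h by rewrite /c'' addrC addKr.
have hc'' : v (c'' - c0) <= eta'.
  by rewrite -(subrK c' c'') dc -addrA; apply: unormD_le.
have grow i : (i <= j.+1)%N ->
    v (orb c'' (s + i) - orb c' (s + i)) = v z ^+ (p ^ i).
  elim: i => [|i ih] hi.
    by rewrite !addn0 disk_orb_diff // dc vh mulrC divfK ?expn0 ?expr1 // gt_eqF.
  have {}ih := ih (ltnW hi).
  have lo : rCrit < v (orb c'' (s + i) - orb c' (s + i)).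
    by rewrite ih (lt_le_trans _ (zi _ (ltnW hi))) // (le_lt_trans _ z'1) // le_max lexx.
  have up : v (orb c'' (s + i) - orb c' (s + i)) <= 1.
    by rewrite ih exprn_ile1 ?unorm_ge0 // ltW.
  have W'' : v (orb c'' (s + i)) <= rW.
    rewrite -(subrK (orb c' (s + i)) (orb c'' _)); apply: unormD_le; last exact: W.
    by rewrite (le_trans up) // ltW.
  have pw := fam_wild_pow (disk_le1 hc') (W _ hi) lo up.
  rewrite addnS !orbS -(subrK (fam c' (orb c'' (s + i))) (fam c'' _)) -addrA.
  rewrite unormDr pw ih -exprM -expnSr //.
  rewrite (fam_param_wild _ _ W'') dc vh.
  apply: lt_le_trans (zi _ hi); apply: le_lt_trans z'1; rewrite le_max; apply/orP; right.
  by rewrite ler_pM2r ?invr_gt0 // (le_trans (ltW z1)) // ltW.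
have [|c hc cw] := @exists_preimage_near _ _ v (orbp (s + j.+1)) c'' c' w.
  rewrite !orbpE grow // -vz' unorm_distC (le_trans hw) // ltW //.
  by rewrite (le_lt_trans _ z'1) // le_max lexx orbT.
rewrite dc in hc; rewrite orbpE in cw.
have hcc : v (c - c0) <= eta'.
  by rewrite -(subrK c' c) -addrA; apply: unormD_le => //; exact: le_trans he'.
exists c; split=> //.
have close i : (i <= j)%N -> v (orb c (s + i) - orb c' (s + i)) <= 1.
  elim: i => [|i ih] hi.
    rewrite !addn0 disk_orb_diff // mulrC -ler_pdivlMr // (le_trans hc) // vh.
    by rewrite ler_pM2r ?invr_gt0 // ltW.
  have {}ih := ih (ltnW hi).
  rewrite addnS !orbS.
  apply: le_trans (wild_diff _ (disk_le1 hc') (W _ (ltnW hi)) ih) _.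
  rewrite ge_max growth_le1 ?unorm_ge0 //=.
  by rewrite (le_trans hc) // (le_trans he') // ltW.
move=> i hi; rewrite -(subrK (orb c' (s + i)) (orb c _)); apply: unormD_le; last exact: W.
by rewrite (le_trans (close _ hi)) // ltW.
Qed.

(** Induction on [j]. For [j = 0] the expansion near [omega] covers the disk of radius [rOm].
    Otherwise a wild preimage [z] of [w] under [fam c0] is reached one step earlier by some [c'];
    then [fam c' z] misses [w] by at most [eta'], and [cover_correct] applies. *)
Lemma cover_param j w : v w <= rOm -> exists c, [/\ v (c - c0) <= eta',
  orb c (s + j) = w & forall i, (i < j)%N -> v (orb c (s + i)) <= rW].
Proof.
elim: j w => [|j ih] w wT.
  pose h := omega / omega ^+ (p.-1 * n).
  have vL : v (omega ^+ (p.-1 * n)) = rate ^+ n by rewrite unormX v_omega exprM.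
  have vh : v h = eta' by rewrite unorm_div vL v_omega.
  have e0 : v (c0 - c0) <= eta' by rewrite subrr unorm0 divr_ge0 // ltW.
  have hD : v (c0 + h - c0) <= eta' by rewrite addrC addKr vh.
  have [|c hc cw] := @exists_preimage_near _ _ v (orbp s) (c0 + h) c0 w.
    rewrite !orbpE disk_orb_diff // (addrC c0) addrK vh mulrC divfK ?gt_eqF //.
    by rewrite orb_omega_add; apply: unormB_le; rewrite ?v_omega.
  exists c; split=> //; last by rewrite addn0 -orbpE.
  exact: le_trans hc hD.
have [z zB Fz] := fam_wild_preim (ltW c01) wT.
have [c' [hc' cz W]] := ih z (le_trans zB (ltW BT)).
apply: (cover_correct hc') => [i|].
  by rewrite leq_eqVlt => /orP[/eqP->|/W //]; rewrite cz.
rewrite addnS orbS cz -Fz (fam_param_wild) //.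
Qed.

End Covering.

(* The number [n] of steps near [omega] is imposed by [rho]: the disk must be
   expanded to a radius in [[rCrit, kappa)], so that the next wild step raises it
   to the power [p]. The length [m] of the following wild stage is then taken large
   enough to make the orbit forget its earlier dependence on the parameter. *)
Lemma next_landing c0 N eta rho : landing c0 N eta rho ->
  exists c1 N1 eta1 rho1, [/\ landing c1 N1 eta1 rho1, (N < N1)%N,
    eta1 <= eta * kappa,
    forall c, v (c - c1) < eta1 -> v (c - c0) < eta &
    forall c, v (c - c1) < eta1 -> v (orb c N - omega) < 1 /\
      exists s, [/\ (N < s)%N, (s < N1)%N, v (orb c s) <= rW & rCrit <= rad c s]].
Proof.
move=> [c01 /andP[eta0 eta1] com cadm crad ciso [rho0 rhoT]].
have rhod : rho < rCrit.
  rewrite -(ltr_pM2r T0); apply: lt_le_trans rhoT _.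
  by rewrite ler_pM2l // (le_trans eta1) // ltW.
have ex : exists n, rCrit <= rho * rate ^+ n.
  have [n hn] := exprn_unbounded (rCrit / rho) L1; exists n.
  by rewrite mulrC -ler_pdivrMr // ltW.
case: (ex_minnP ex) => [[|n']] hn nmin; first by move: hn; rewrite expr0 mulr1 leNgt rhod.
(* By minimality the radius is below [rCrit] one step earlier, and [rate * rCrit = kappa]. *)
have hn' : rho * rate ^+ n'.+1 < kappa.
  have : ~~ (rCrit <= rho * rate ^+ n') by apply/negP => /nmin; rewrite ltnn.
  rewrite -ltNge -(ltr_pM2l L0) rate_rCrit //; apply: le_lt_trans.
  by rewrite exprS mulrCA.
set n := n'.+1 in hn hn' nmin; have n0 : (0 < n)%N by [].
have Ln0 : 0 < rate ^+ n by exact: exprn_gt0.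
pose eta' := rOm / rate ^+ n.
have eta'_lt : eta' < eta.
  rewrite ltr_pdivrMr //.
  (* By [landing_rho], the parameters needed to cover the disk of radius [rOm] after [n] steps
     remain within [eta] of [c0]. *)
  have h : rho * rOm < eta * (rho * rate ^+ n).
    by apply: lt_le_trans rhoT _; rewrite mulrC ler_pM2l.
  by rewrite -(ltr_pM2l rho0) [ltRHS]mulrCA.
(* With this radius, the differences between orbits at time [N + n] stay below [kappa], where wild
   steps contract. *)
pose eta2 := kappa / rate ^+ n.
have eta20 : 0 < eta2 by rewrite divr_gt0.
have eta2' : eta2 <= eta'.
  by rewrite ler_pM2r ?invr_gt0 // (le_trans (ltW k1)) // ltW.
(* The first bound lets [wild_stage] absorb the factor [rate ^+ n]; the second gives [landing_rho]
   for the new landing. *)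
have [m hm] : exists m, kappa ^+ m < Num.min (rate ^+ n)^-1 (rCrit * eta2 / rOm).
  by apply: kappa_pow_small; rewrite lt_min invr_gt0 Ln0 /= divr_gt0 // mulr_gt0.
move: hm; rewrite lt_min => /andP[hm1 hm2].
have omT : v omega <= rOm by rewrite v_omega.
have [c1 [hc1 c1om W1]] := cover_param c01 eta1 eta'_lt com ciso m.+1 omT.
set s := (N + n)%N in c1om W1.
have sub c : v (c - c1) < eta2 -> v (c - c0) <= eta'.
  move=> h; rewrite -(subrK c1 c) -addrA; apply: unormD_le => //.
  by rewrite ltW // (lt_le_trans h).
have sub' c : v (c - c1) < eta2 -> v (c - c0) < eta by move=> /sub/le_lt_trans; apply.
have near c : v (c - c1) < eta2 -> rate ^+ n * v (orb c N - omega) <= rOm.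
  by move=> /sub h; apply: (disk_near eta'_lt com ciso h).
have le1 c : v (c - c1) < eta2 -> v c <= 1 by move=> /sub h; apply: (disk_le1 c01 eta1 eta'_lt h).
have c11 : v c1 < 1.
  rewrite -(subrK c0 c1); apply: unormD_lt => //.
  by rewrite (le_lt_trans hc1) // (lt_le_trans eta'_lt).
have Ln1 : 1 <= rate ^+ n by rewrite exprn_ege1 // ltW.
have [W iso2] : (forall c i, v (c - c1) < eta2 -> (i <= m)%N -> v (orb c (s + i)) <= rW) /\
  (forall c c', v (c - c1) < eta2 -> v (c' - c1) < eta2 ->
     v (orb c' (s + m.+1) - orb c (s + m.+1)) = v (c' - c)).
  apply: (@wild_stage c1 s m (rate ^+ n) eta2) => //.
  - exact: ltW.
  - by rewrite ler_pdivrMr // ler_peMr // ltW.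
  - by rewrite mulrC divfK ?gt_eqF.
  - by rewrite -ler_pdivlMr // div1r ltW.
  - move=> c c' h h'; rewrite (disk_orb_diff c01 eta1 eta'_lt com ciso (sub _ h) (sub _ h')) //.
have radn c j : v (c - c1) < eta2 -> (j <= n)%N -> rad c (N + j) = rate ^+ j * rho.
  by move=> h; apply: (rad_near (le1 _ h) (near _ h) (crad _ (sub' _ h))).
have rads c : v (c - c1) < eta2 -> rad c s = rho * rate ^+ n.
  by move=> h; rewrite mulrC -(radn c).
have rs0 : 0 < rho * rate ^+ n by rewrite mulr_gt0.
have radw c i : v (c - c1) < eta2 -> (i <= m.+1)%N -> rad c (s + i) = iter i growth (rho * rate ^+ n).
  move=> h; apply: rad_wild (rads _ h) _ _ => k hk; exact: W.
have [r10 r1k] := iter_growth_bounds m.+1 rs0 hn'.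
exists c1, (s + m.+1)%N, eta2, (iter m.+1 growth (rho * rate ^+ n)); split=> //.
- split=> //.
  + by rewrite eta20 (le_trans eta2') // (le_trans (ltW eta'_lt)).
  + move=> c k h hk; have [kN|Nk] := ltnP k N; first exact: cadm (sub' _ h) kN.
    have [ks|sk] := ltnP k s.
      have -> : k = (N + (k - N))%N by rewrite subnKC.
      have kn : (k - N < n)%N by rewrite ltn_subLR.
      split; first by right; exact: (near_stage_lt (le1 _ h) (near _ h) kn).
      rewrite (radn _ _ h (ltnW kn)) mulr_gt0 ?(exprn_gt0 _ L0) //=.
      apply: le_lt_trans hn'; rewrite mulrC ler_pM2l //.
      exact: ler_weXn2l (ltW L1) _ _ (ltnW kn).
    rewrite -(subnKC sk).
    have km : (k - s < m.+1)%N by rewrite ltn_subLR.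
    split; first by left; exact: W.
    rewrite (radw _ _ h (ltnW km)).
    have [h0 hb] := iter_growth_bounds (k - s) rs0 hn'.
    rewrite h0 /=; apply: le_lt_trans hb _; apply: le_lt_trans hn'.
    by rewrite ler_piMl ?(ltW rs0) // exprn_ile1 // ltW.
  + by move=> c h; exact: radw.
  + split=> //; rewrite -ltr_pdivlMr //; apply: le_lt_trans r1k _; apply: le_lt_trans hm2.
    rewrite exprSr -mulrA ler_piMr ?exprn_ge0 ?(ltW k0) //.
    by rewrite mulr_ile1 // ltW // (lt_trans hn').
- by rewrite /s -addnA -[ltnLHS]addn0 ltn_add2l addn_gt0 n0.
- apply: le_trans (_ : eta' * kappa <= _); last by rewrite ler_pM2r // ltW.
  by rewrite /eta2 /eta' mulrAC [_ * kappa]mulrC ler_pM2r ?invr_gt0 // ler_peMr // ltW.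
- move=> c h; split.
    rewrite -com ciso ?subrr ?unorm0 //; last exact: sub'.
    by apply: lt_le_trans (sub' _ h) _.
  exists s; split.
  + by rewrite /s -[ltnLHS]addn0 ltn_add2l.
  + by rewrite -[ltnLHS]addn0 ltn_add2l.
  + by have := W _ 0%N h isT; rewrite addn0.
  + by rewrite rads.
Qed.

(** At time [0] all orbits are at [x0], whatever the parameter, so [wild_stage] applies with
    [E = 0]. *)
Lemma init_landing m : 0 < r < kappa -> kappa ^+ m < rCrit * kappa / rOm ->
  (forall i, (i <= m)%N -> v (orb 0 i) <= rW) -> orb 0 m.+1 = omega ->
  landing 0 m.+1 kappa (iter m.+1 growth r).
Proof.
move=> /andP[r0 rk] hm W horb.
have [W' iso] : (forall c i, v (c - 0) < kappa -> (i <= m)%N -> v (orb c (0 + i)) <= rW) /\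
  (forall c c', v (c - 0) < kappa -> v (c' - 0) < kappa ->
     v (orb c' (0 + m.+1) - orb c (0 + m.+1)) = v (c' - c)).
  apply: (@wild_stage 0 0 m 0 kappa) => //.
  - by rewrite unorm0.
  - by rewrite mul0r ltW.
  - by rewrite mulr0.
  - by move=> c c' _ _; rewrite subrr unorm0 mul0r.
have radE c i : v (c - 0) < kappa -> (i <= m.+1)%N -> rad c i = iter i growth r.
  move=> h; apply: (@rad_wild c 0 m.+1 r erefl) => j hj; exact: W'.
split=> //.
- by rewrite unorm0.
- by rewrite k0 ltW.
- move=> c n h hn; split; first by left; exact: W'.
  rewrite radE // ?(ltnW hn) //.
  have [h0 hb] := iter_growth_bounds n r0 rk.
  rewrite h0 /=; apply: le_lt_trans hb _; apply: le_lt_trans rk.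
  by rewrite ler_piMl ?(ltW r0) // exprn_ile1 // ltW.
- by move=> c h; exact: radE.
- have [h0 hb] := iter_growth_bounds m.+1 r0 rk.
  split=> //; rewrite -ltr_pdivlMr //; apply: le_lt_trans hb _; apply: le_lt_trans hm.
  rewrite exprSr -mulrA ler_piMr ?exprn_ge0 ?(ltW k0) //.
  by rewrite mulr_ile1 // ltW // (lt_trans rk).
Qed.

(** Repeated wild preimages; with [w = omega] this provides the centre [x0]. *)
Lemma exists_wild_chain m w : v w <= rOm ->
  exists2 x, iter m.+1 (fam 0) x = w & forall i, (i <= m)%N -> v (iter i (fam 0) x) <= rW.
Proof.
have c0 : v 0 <= 1 by rewrite unorm0.
elim: m => [|m ih] wT.
  have [z zB zw] := fam_wild_preim c0 wT.
  by exists z => // i; rewrite leqn0 => /eqP->.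
have [z zw zB] := ih wT.
have [|x xB xz] := fam_wild_preim c0 (w := z).
  by rewrite (le_trans (zB 0%N isT)) // ltW.
exists x; first by rewrite iterSr xz.
by case=> [//|i]; rewrite ltnS => hi; rewrite iterSr xz zB.
Qed.

Hypothesis v_complete : complete_norm v.

(** Iterating [next_landing] gives nested disks of parameters with radii tending to [0]. Their
    common point inherits the itineraries of all the landings. *)
Lemma exists_good_param N0 eta0 rho0 c0 : landing c0 N0 eta0 rho0 ->
  exists c, [/\ v c <= 1, forall n, admissible c n,
    forall k, exists2 N, (k <= N)%N & v (orb c N - omega) < 1 &
    forall k, exists2 s, (k <= s)%N & v (orb c s) <= rW /\ rCrit <= rad c s].
Proof.
move=> land0.
pose St := (K * nat * R * R)%type.
pose Lst (s : St) := landing s.1.1.1 s.1.1.2 s.1.2 s.2.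
pose nxt (s t : St) := [/\ Lst t, (s.1.1.2 < t.1.1.2)%N, t.1.2 <= s.1.2 * kappa,
    forall c, v (c - t.1.1.1) < t.1.2 -> v (c - s.1.1.1) < s.1.2 &
    forall c, v (c - t.1.1.1) < t.1.2 -> v (orb c s.1.1.2 - omega) < 1 /\
      exists k, [/\ (s.1.1.2 < k)%N, (k < t.1.1.2)%N, v (orb c k) <= rW & rCrit <= rad c k]].
have /choice[f hf] : forall s : St, exists t, Lst s -> nxt s t.
  move=> s.
  have [ls|nls] := pselect (Lst s); last by exists s => /nls.
  have [c1 [N1 [eta1 [rho1 h]]]] := next_landing ls.
  by exists (c1, N1, eta1, rho1).
pose S n := iter n f (c0, N0, eta0, rho0).
have LS n : Lst (S n) by elim: n => [|n ih] //; have [] := hf _ ih.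
have SS n : nxt (S n) (S n.+1) by apply: hf; exact: LS.
pose C n := (S n).1.1.1; pose NN n := (S n).1.1.2; pose E n := (S n).1.2.
have E0 n : 0 < E n by have [_ /andP[]] := LS n.
have NNn n : (n <= NN n)%N.
  by elim: n => [//|n ih]; have [_ h _ _ _] := SS n; exact: leq_ltn_trans h.
have En n : E n <= kappa ^+ n.
  elim: n => [|n ih]; first by rewrite expr0; have [_ /andP[]] := LS 0%N.
  have [_ _ h _ _] := SS n; apply: le_trans h _.
  by rewrite exprSr ler_pM2r.
have sub n k c : v (c - C (n + k)%N) < E (n + k)%N -> v (c - C n) < E n.
  elim: k c => [|k ih] c; first by rewrite addn0.
  by rewrite addnS => h; apply: ih; have [_ _ _ hs _] := SS (n + k)%N; exact: hs.
have cC n k : (n <= k)%N -> v (C k - C n) < E n.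
  by move=> hk; apply: (sub n (k - n)%N); rewrite subnKC // subrr unorm0.
have small (t : R) : 0 < t -> exists n, E n < t.
  by move=> e0; have [n hn] := kappa_pow_small e0; exists n; exact: le_lt_trans hn.
have [|c hc] := @v_complete C.
  move=> e /small[n hn]; exists n => i j hi hj; apply: lt_trans hn.
  by apply: unorm_dist_lt (cC _ _ hi) _; rewrite unorm_distC cC.
(* Open ultrametric disks are closed, so the limit belongs to each of them. *)
have cD n : v (c - C n) < E n.
  move/cvgrPdist_lt : hc => /(_ _ (E0 n))[k _ hk].
  have /= := hk (maxn n k) (leq_maxr _ _); rewrite sub0r normrN ger0_norm ?unorm_ge0 // => h.
  apply: unorm_dist_lt (cC _ _ (leq_maxl n k)); by rewrite unorm_distC.
exists c; split.
- rewrite -(subrK (C 0%N) c); have [c01 /andP[_ e1] _ _ _ _ _] := LS 0%N.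
  by apply: unormD_le; rewrite ltW // (lt_le_trans (cD 0%N)).
- move=> n; have [_ _ _ h _ _ _] := LS n.+1; apply: h; first exact: cD.
  exact: (NNn n.+1).
- move=> k; exists (NN k) => //; have [_ _ _ _ h] := SS k.
  by have [] := h _ (cD k.+1).
- move=> k; have [_ _ _ _ h] := SS k.
  have [_ [s [h1 h2 h3 h4]]] := h _ (cD k.+1).
  by exists s => //; rewrite (leq_trans (NNn k)) // ltnW.
Qed.

(** * Expansion beyond the disk *)

Section GoodParameter.
Variable c : K.
Hypotheses (c1 : v c <= 1) (r_gt0 : 0 < r) (c_adm : forall n, admissible c n).
Hypothesis c_near : forall k, exists2 N, (k <= N)%N & v (orb c N - omega) < 1.
Hypothesis c_wild : forall k, exists2 s, (k <= s)%N & v (orb c s) <= rW /\ rCrit <= rad c s.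

Lemma rad_gt0 n : 0 < rad c n. Proof. by have [_ /andP[]] := c_adm n. Qed.
Lemma rad_lt1 n : rad c n < 1.
Proof. by have [_ /andP[_ h]] := c_adm n; exact: lt_trans h k1. Qed.

Lemma orb_bounded n : v (orb c n) <= rOm.
Proof.
have [[h|h] _] := c_adm n; first by rewrite (le_trans h) // ltW.
by rewrite (v_near h).
Qed.

Lemma disk_shrinks n z : v (z - x0) < r -> v (iter n (fam c) z - orb c n) <= rad c n.
Proof.
move=> hz; elim: n => [|n ih]; first exact: ltW.
have e1 : v (iter n (fam c) z - orb c n) <= 1 by rewrite (le_trans ih) // ltW // rad_lt1.
rewrite iterS orbS /=; have [hW|hN] := leP (v (orb c n)) rW.
  apply: le_trans (fam_wild_le c1 hW e1) _.
  exact: growth_mono (unorm_ge0 _ _) ih.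
have [[h|h] _] := c_adm n; first by rewrite leNgt hN in h.
rewrite fam_near //; first by rewrite ler_pM2l.
by apply: unorm_dist_lt h; rewrite (le_lt_trans e1).
Qed.

Lemma orb_separated k : exists n1 n2, [/\ (k <= n1)%N, (k <= n2)%N &
  1 < v (orb c n1 - orb c n2)].
Proof.
have [n1 h1 [W1 _]] := c_wild k; have [n2 h2 N2] := c_near k.
exists n1, n2; split=> //.
have e2 : v (orb c n2) = rOm by apply: v_near; exact: lt_trans T1.
by rewrite unormBr e2 // (le_lt_trans W1).
Qed.

Section Cover.
Variables (r2 : R) (r2_gt : r < r2).

Definition covers n (t : R) := forall w, v (w - orb c n) < t ->
  exists2 z, v (z - x0) < r2 & iter n (fam c) z = w.

Lemma covers_le n t t' : t' <= t -> covers n t -> covers n t'.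
Proof. by move=> h hc w hw; apply: hc; exact: lt_le_trans h. Qed.

(** By [exists_preimage_near], it suffices to find in the covered disk a point whose image is at
    least as far from the centre as [w]. *)
Lemma covers_step n t t' : covers n t ->
  (forall w, v (w - orb c n.+1) < t' ->
    exists2 x, v (x - orb c n) < t & v (w - orb c n.+1) <= v (fam c x - orb c n.+1)) ->
  covers n.+1 t'.
Proof.
move=> ht h w hw; have [x hx hwx] := h w hw.
have [|x' hx' Fx'] := @exists_preimage_near _ _ v (fam_poly c) x (orb c n) w.
  by rewrite !fam_polyE.
have [z hz zx'] := ht x' (le_lt_trans hx' hx).
by exists z => //; rewrite iterS zx' -fam_polyE.
Qed.

Lemma exists_unorm_dist x t t' : 0 < t' -> t < t' -> exists x', t < v (x' - x) < t'.
Proof.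
move=> h1 h2; have [e he] := exists_unorm_between v_nontrivial h1 h2.
by exists (x + e); rewrite addrC addKr.
Qed.

Lemma covers_wild n t : 0 < t -> t <= 1 -> v (orb c n) <= rW ->
  covers n t -> covers n.+1 (growth t).
Proof.
move=> t0 t1 W ht; apply: covers_step ht _ => w hw; set q := v (w - _) in hw *.
have p0 : (0 < p)%N := ltnW (p_gt1).
have [td|dt] := leP t rCrit.
  have hq : q < v theta * t.
    apply: lt_le_trans hw _; rewrite /growth ge_max lexx andbT.
    move: td; rewrite le_eqVlt => /orP[/eqP->|td]; last exact: ltW (pow_lt_theta t0 td).
    by rewrite v_theta -exprSr prednK.
  have [|x /andP[hx1 hx2]] := @exists_unorm_dist (orb c n) (q / v theta) t t0.
    by rewrite ltr_pdivrMr ?v_theta_gt0 // mulrC.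
  exists x => //; rewrite orbS (fam_wild_lin c1 W (lt_le_trans hx2 td)).
  by rewrite mulrC -ler_pdivrMr ?v_theta_gt0 // ltW.
have hq : q < t ^+ p.
  apply: lt_le_trans hw _; rewrite /growth ge_max lexx /=.
  exact: ltW (theta_lt_pow dt).
(* The bound [rCrit ^+ p] forces a [p]-th root of [z'] to have norm above [rCrit], as [fam_wild_pow]
   requires. *)
have [|z' /andP[hz1 hz2]] := exists_unorm_between v_nontrivial (exprn_gt0 p t0) (r1 := Num.max q (rCrit ^+ p)).
  by rewrite gt_max hq ltrXn2r ?nnegrE ?(ltW d0) ?(ltW t0) // -lt0n.
have [e ez] := @exists_nth_root K z' p p0.
have ve : v z' = v e ^+ p by rewrite -ez unormX.
move: hz1; rewrite gt_max ve => /andP[qe de].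
have et : v e < t by move: hz2; rewrite ve ltr_pXn2r ?nnegrE ?unorm_ge0 ?(ltW t0).
have de' : rCrit < v e by move: de; rewrite ltr_pXn2r ?nnegrE ?unorm_ge0 ?(ltW d0).
exists (orb c n + e); rewrite (addrC (orb c n)) ?addrK // -/(orb c n).
rewrite orbS (fam_wild_pow c1 W) addrK // ?(ltW qe) //.
by rewrite ltW // (lt_le_trans et).
Qed.

Lemma covers_near n t : 0 < t -> t <= 1 -> v (orb c n - omega) < rOm ->
  covers n t -> covers n.+1 (rate * t).
Proof.
move=> t0 t1 h ht; apply: covers_step ht _ => w hw; set q := v (w - _) in hw *.
have [|x /andP[hx1 hx2]] := @exists_unorm_dist (orb c n) (q / rate) t t0.
  by rewrite ltr_pdivrMr // mulrC.
exists x => //; rewrite orbS fam_near //.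
  by rewrite mulrC -ler_pdivrMr // ltW.
by apply: unorm_dist_lt h; rewrite (lt_le_trans hx2) // (le_trans t1) // ltW.
Qed.

Lemma growth_scale a rho : 1 <= a -> 0 <= rho -> a * growth rho <= growth (a * rho).
Proof.
move=> a1 h0; have p0 : (0 < p)%N := ltnW (p_gt1).
have a0 : 0 <= a by exact: le_trans a1.
rewrite /growth maxr_pMr // ge_max; apply/andP; split; rewrite le_max; apply/orP.
  by left; rewrite exprMn ler_wpM2r ?exprn_ge0 // -[leLHS]expr1 ler_weXn2l.
by right; rewrite mulrCA.
Qed.

Lemma growth_scale_sqr a rho : 1 <= a -> rCrit <= rho -> a ^+ 2 * growth rho <= growth (a * rho).
Proof.
move=> a1 h0; have p1 := p_gt1.
have a0 : 0 <= a by exact: le_trans a1.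
have r0 : 0 < rho by exact: lt_le_trans h0.
have ge : growth rho <= rho ^+ p.
  rewrite /growth ge_max lexx /=; move: h0; rewrite le_eqVlt => /orP[/eqP<-|h0].
    by rewrite v_theta -exprSr prednK // ltnW.
  exact: ltW (theta_lt_pow h0).
apply: (@le_trans _ _ (a ^+ 2 * rho ^+ p)); first by rewrite ler_wpM2l ?exprn_ge0.
rewrite [leRHS]/growth le_max; apply/orP; left.
by rewrite exprMn ler_wpM2r ?exprn_ge0 ?(ltW r0) // ler_weXn2l.
Qed.

(** As long as no image covers a unit disk, the covered radius cannot exceed [1], and the one-step
    covering estimates apply. *)
Lemma covers_keep_ratio n a : (forall k, ~ covers k 1) -> 1 <= a -> covers n (a * rad c n) ->
  covers n.+1 (a * rad c n.+1).
Proof.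
move=> no a1 h; have a0 : 0 < a by exact: lt_le_trans a1.
have rn := rad_gt0 n.
have lt1 : a * rad c n <= 1.
  rewrite leNgt; apply/negP => /ltW h1; exact: (no n (covers_le h1 h)).
have pos : 0 < a * rad c n by rewrite mulr_gt0.
rewrite /=; have [W|N] := leP (v (orb c n)) rW.
  by apply: covers_le (growth_scale a1 (ltW rn)) _; exact: covers_wild.
have [[hW|hN] _] := c_adm n; first by rewrite leNgt N in hW.
by rewrite mulrCA; exact: covers_near.
Qed.

Lemma covers_one_from n k : covers n 1 -> (n <= k)%N -> covers k 1.
Proof.
move=> h; elim: k => [|k ih]; first by rewrite leqn0 => /eqP<-.
rewrite leq_eqVlt => /orP[/eqP<- //|]; rewrite ltnS => /ih{}ih.
have [[hW|hN] _] := c_adm k.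
  by apply: covers_le (covers_wild ltr01 (lexx _) hW ih); rewrite /growth le_max expr1n lexx.
by apply: covers_le (covers_near ltr01 (lexx _) hN ih); rewrite mulr1 ltW.
Qed.

(* The ratio of the radius covered to [rad c n] never decreases, and it is raised
   at least to the square at each wild step with [rCrit <= rad c n]. *)
Lemma exists_covers_one : exists n, covers n 1.
Proof.
apply: contrapT => /forallNP no; pose a := r2 / r.
have a1 : 1 < a by rewrite ltr_pdivlMr ?mul1r.
have a1' k : 1 <= a ^+ k by rewrite exprn_ege1 // ltW.
have keep n s b : (n <= s)%N -> 1 <= b -> covers n (b * rad c n) -> covers s (b * rad c s).
  move=> + b1 hn; elim: s => [|s ih]; first by rewrite leqn0 => /eqP<-.
  rewrite leq_eqVlt => /orP[/eqP<- //|]; rewrite ltnS => /ih{}ih.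
  exact: covers_keep_ratio.
have grow k : exists n, covers n (a ^+ k.+1 * rad c n).
  elim: k => [|k [n hn]].
    by exists 0%N; rewrite expr1 /= /a divfK ?gt_eqF // => w hw; exists w.
  have [s ns [W d]] := c_wild n; exists s.+1.
  have hs := keep _ _ _ ns (a1' k.+1) hn.
  have pos : 0 < a ^+ k.+1 * rad c s by rewrite mulr_gt0 ?rad_gt0 // (lt_le_trans ltr01).
  have lt1 : a ^+ k.+1 * rad c s <= 1.
    rewrite leNgt; apply/negP => /ltW h1; exact: (no s (covers_le h1 hs)).
  have := covers_wild pos lt1 W hs; apply: covers_le; rewrite /= W.
  apply: le_trans (growth_scale_sqr (a1' k.+1) d).
  rewrite ler_pM2r ?growth_gt0 ?rad_gt0 // -exprM ler_weXn2l ?(ltW a1) //.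
  by rewrite muln2 -addnn addSn addnS ltnS leq_addr.
have [k hk] := exprn_unbounded rCrit^-1 a1.
have [n hn] := grow k; have [s ns [_ d]] := c_wild n.
have hs := keep _ _ _ ns (a1' k.+1) hn.
apply: (no s); apply: covers_le hs.
apply: (@le_trans _ _ (a ^+ k.+1 * rCrit)); last by rewrite ler_wpM2l // (le_trans ler01).
rewrite -ler_pdivrMr // div1r (le_trans (ltW hk)) // exprS ler_peMl ?ltW //.
by rewrite exprn_gt0 // (lt_trans ltr01).
Qed.

Fixpoint iterp n : {poly K} := if n is m.+1 then fam_poly c \Po iterp m else 'X.

Lemma iterpE n z : (iterp n).[z] = iter n (fam c) z.
Proof. by elim: n => [|n ih]; rewrite ?hornerX // iterS -fam_polyE horner_comp ih. Qed.

(** [w] is placed so that [k.+1] steps bring it to distance [v y ^+ 4] from [omega]. This lies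
    between [rOm] and [rate * rOm]: the linear expansion holds up to the last step, after which
    [fam_escape] takes over. *)
Lemma exists_escaping N : v (orb c N - omega) < 1 -> exists w k,
  v (w - orb c N) < 1 /\ forall i, v y ^+ i <= v (iter (k + i) (fam c) w).
Proof.
move=> hN; have b_gt0 : 0 < v y by exact: lt_trans y1.
have [k yk] := exprn_unbounded (v y ^+ 4) L1.
pose w := omega + y ^+ 4 / omega ^+ (p.-1 * k.+1).
have vL : v (omega ^+ (p.-1 * k.+1)) = rate ^+ k.+1 by rewrite unormX v_omega exprM.
have Lk : 0 < rate ^+ k.+1 := exprn_gt0 _ L0.
have dw : v (w - omega) = v y ^+ 4 / rate ^+ k.+1.
  by rewrite /w addrC addKr unorm_div vL unormX.
have w1 : v (w - omega) < 1.
  rewrite dw ltr_pdivrMr // mul1r (lt_le_trans yk) //.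
  by rewrite exprS ler_peMl ?exprn_ge0 ?ltW.
have y4T : rOm < v y ^+ 4 by rewrite /rOm ltr_eXn2l.
have y4 : v y ^+ 4 < rate * rOm.
  apply: lt_le_trans (_ : rOm * rOm <= _); last by rewrite ler_pM2r // rOm_le_rate.
  by rewrite /rOm -exprD ltr_eXn2l.
have Lw : rate ^+ k.+1 * v (w - omega) = v y ^+ 4 by rewrite dw mulrC divfK ?gt_eqF.
have hk : rate ^+ k * v (w - omega) < rOm by rewrite -(ltr_pM2l L0) (mulrA rate) -exprS Lw.
have hk2 := near_iter c1 (ltW hk) (leqnn k).
have hk3 : v (iter k.+1 (fam c) w - omega) = v y ^+ 4.
  by rewrite iterS fam_near_omega // hk2 // (mulrA rate) -exprS.
have {}hk3 : v (iter k.+1 (fam c) w) = v y ^+ 4.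
  by rewrite -(subrK omega (iter _ _ _)) unormDl hk3 // v_omega.
exists w, k.+1; split; first by apply: unorm_dist_lt w1 _; rewrite unorm_distC.
move=> i; apply: (@le_trans _ _ (v y ^+ i * v y ^+ 4)).
  by rewrite ler_peMr ?exprn_ge0 ?(ltW b_gt0) // exprn_ege1 // ltW.
have lo j : v y ^+ 4 <= v y ^+ j * v y ^+ 4.
  by rewrite ler_peMl ?exprn_ge0 ?(ltW b_gt0) // exprn_ege1 // ltW.
elim: i => [|i ih]; first by rewrite addn0 hk3 expr0 mul1r.
rewrite addnS iterS.
apply: le_trans (fam_escape c1 _); last first.
  by apply: lt_le_trans ih; exact: lt_le_trans (lo i).
by rewrite exprS -mulrA ler_pM2l.
Qed.

(** Some image of the larger disk contains an escaping point, whereas the orbit of [x0] is bounded;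
    by [exists_preimage_near], an image of the disk that contains points so far apart covers every
    bounded set. *)
Lemma eventually_covers S : exists n0, forall n, (n0 <= n)%N -> forall w, v w <= S ->
  exists2 z, v (z - x0) < r2 & iter n (fam c) z = w.
Proof.
have [n1 h1] := exists_covers_one; have [N n1N hN] := c_near n1.
have [w0 [k [hw0 esc]]] := exists_escaping hN.
have [z hz zw0] := covers_one_from h1 n1N hw0.
have [i hi] := exprn_unbounded (Num.max S rOm) y1.
exists (N + k + i)%N => n hn w wS.
have big : Num.max S rOm < v (iter n (fam c) z).
  apply: lt_le_trans hi _; have -> : n = (k + (n - N - k) + N)%N.
    by move: hn; clear; lia.
  rewrite iterD zw0; apply: le_trans (esc _).
  by rewrite ler_weXn2l ?(ltW y1) //; move: hn; clear; lia.
have [|z' hz' z'w] := @exists_preimage_near _ _ v (iterp n) z x0 w.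
  rewrite !iterpE -/(orb c n).
  have le1 : v (orb c n) <= Num.max S rOm by rewrite le_max orb_bounded orbT.
  rewrite (unormBl (le_lt_trans le1 big)) (le_trans _ (ltW big)) //.
  by apply: unormB_le; rewrite // le_max wS.
by exists z'; [exact: le_lt_trans hz|rewrite -iterpE].
Qed.

End Cover.
End GoodParameter.
End Family.

(** These four properties are all that the study of the Fatou component retains from the
    construction. *)
Record wandering_disk (R : realType) (K : closedFieldType) (v : ultrametric_norm R K)
    (P : {poly K}) (x : K) (r : R) : Prop := WanderingDisk {
  wandering_bounded : exists M, forall n, v (iter n (horner P) x) <= M;
  wandering_shrinks : forall n z, v (z - x) < r ->
    v (iter n (horner P) z - iter n (horner P) x) <= 1;
  wandering_separated : forall k, exists n1 n2, [/\ (k <= n1)%N, (k <= n2)%N &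
    1 < v (iter n1 (horner P) x - iter n2 (horner P) x)];
  wandering_covers : forall r2 S, r < r2 -> exists n0, forall n, (n0 <= n)%N ->
    forall w, v w <= S -> exists2 z, v (z - x) < r2 & iter n (horner P) z = w }.

(** * Existence of a wandering disk of radius outside [D] *)

Section Existence.
Variables (R : realType) (K : closedFieldType) (v : ultrametric_norm R K).
Hypothesis v_nontrivial : nontrivial_norm v.

Lemma exists_base (p : nat) : prime p -> v p%:R < 1 ->
  exists2 y, 1 < v y & v p%:R * v y ^+ ((3 * p + 2) * p.-1) < 1.
Proof.
move=> pp p1; set M := ((3 * p + 2) * p.-1)%N.
have M0 : (0 < M)%N by move: (prime_gt1 pp); rewrite /M; clear; case: p => [|[|p]].
(* The term [2^-1] keeps [q] invertible when [p] is zero in [K]. *)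
pose q := Num.max (v p%:R) 2^-1.
have q0 : 0 < q by rewrite lt_max invr_gt0 ltr0n orbT.
have q1 : 1 < q^-1 by rewrite invf_gt1 // gt_max p1 invf_lt1 // ltr1n.
have [z' /andP[z1 z2]] := exists_unorm_near1 v_nontrivial q1.
have [y yz] := @exists_nth_root K z' M M0.
have vz : v z' = v y ^+ M by rewrite -yz unormX.
exists y.
  by rewrite ltNge; apply/negP => h; move: z1; rewrite vz ltNge exprn_ile1 ?unorm_ge0.
rewrite -vz; apply: le_lt_trans (_ : q * v z' < 1).
  by rewrite ler_wpM2r ?unorm_ge0 // le_max lexx.
by rewrite -ltr_pdivlMl // mulr1.
Qed.

(** A number outside the group [D] stays outside when multiplied by norms, and there are arbitrarily
    small ones. *)
Lemma exists_small_radius (D : set R) (t : R) : 0 < t -> divisible_subgroup D ->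
  D `<` [set r : R | 0 < r] -> value_group v `<=` D -> exists2 r, 0 < r < t & ~ D r.
Proof.
move=> t0 Dd [_ Dp] vD.
have [r0 r00 nD] : exists2 r0 : R, 0 < r0 & ~ D r0.
  apply: contrapT => h; apply: Dp => s s0; apply: contrapT => nDs.
  by apply: h; exists s.
have [|z /andP[z0 zt]] := exists_unorm_between v_nontrivial _ (divr_gt0 t0 r00).
  exact: divr_gt0.
have Dz : D (v z) by apply: vD; exists z => //=; rewrite -(unorm_gt0 v).
exists (v z * r0); first by rewrite mulr_gt0 // -ltr_pdivlMr.
move=> h; apply: nD.
have -> : r0 = (v z)^-1 * (v z * r0) by rewrite mulKf // gt_eqF.
by apply: divsubM => //; exact: divsubV.
Qed.

Lemma exists_wandering_disk (D : set R) : complete_norm v -> positive_residue_char v ->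
  divisible_subgroup D -> D `<` [set r : R | 0 < r] -> value_group v `<=` D ->
  exists (P : {poly K}) (x : K) (r : R),
    [/\ (2 < size P)%N, 0 < r, ~ D r & wandering_disk v P x r].
Proof.
move=> v_complete /residue_char_unorm_lt1[p pp p1] Dd Dp vD.
have [y y1 yp] := exists_base pp p1.
have [r /andP[r0 rk] nDr] := exists_small_radius (kappa_gt0 y1) Dd Dp vD.
have t0 : 0 < rCrit v p y * kappa v y / rOm v y.
  by rewrite divr_gt0 ?(rOm_gt0 y1) // mulr_gt0 ?(kappa_gt0 y1) // rCrit_gt0.
have [m hm] := kappa_pow_small y1 t0.
have omT : v (omega y) <= rOm v y by rewrite v_omega.
have [x xom xW] := exists_wild_chain pp y1 m omT.
have rk' : 0 < r < kappa v y by rewrite r0.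
have land := init_landing pp y1 yp rk' hm xW xom.
have [c [c1 cadm cnear cwild]] := exists_good_param pp y1 yp v_nontrivial v_complete land.
have itE n z : iter n (horner (fam_poly p y c)) z = iter n (fam p y c) z.
  by apply: eq_iter => w; rewrite fam_polyE.
exists (fam_poly p y c), x, r; split=> //; first exact: (fam_poly_size pp y1).
split.
- by exists (rOm v y) => n; rewrite itE; exact: orb_bounded cadm n.
- move=> n z hz; rewrite !itE.
  apply: le_trans (disk_shrinks pp y1 yp c1 cadm n hz) _.
  by rewrite ltW // (rad_lt1 y1 cadm).
- move=> k; have [n1 [n2 [h1 h2 h3]]] := orb_separated y1 cnear cwild k.
  by exists n1, n2; rewrite !itE.
- move=> r2 S hr2.
  have [n0 h] := eventually_covers pp y1 yp v_nontrivial c1 r0 cadm cnear cwild hr2 S.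
  exists n0 => n hn w wS; have [z hz zw] := h n hn w wS.
  by exists z; rewrite ?itE.
Qed.

End Existence.

(** * Berkovich points *)

(** The square of Bernoulli's inequality gives a quadratic lower bound. *)
Lemma exprn_dominates (R : archiRealFieldType) (t : R) : 1 < t ->
  exists n, n.+1%:R < t ^+ n.
Proof.
move=> t1; pose a := t - 1; have a0 : 0 < a by rewrite /a; lra.
have bern k : 1 + a * k%:R <= t ^+ k by rewrite bernoulli_ge // ltW.
pose m := (Num.truncn (2 / (a * a))).+1.
have hm : 2 < a * a * m%:R by rewrite mulrC -ltr_pdivrMr ?mulr_gt0 // truncnS_gt.
exists (m * 2)%N; rewrite exprM; apply: lt_le_trans (_ : (1 + a * m%:R) ^+ 2 <= _); last first.
  have k0 : 0 <= a * m%:R by rewrite mulr_ge0 // ltW.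
  by rewrite lerXn2r ?nnegrE ?exprn_ge0 //; lra.
have m0 : 0 < m%:R :> R by rewrite ltr0n.
have -> : ((m * 2).+1)%:R = m%:R * 2 + 1 :> R by rewrite -natr1 natrM.
have h2 : 2 * m%:R < a * a * m%:R * m%:R by rewrite ltr_pM2r.
have h3 : 0 < a * m%:R by rewrite mulr_gt0.
rewrite expr2; nra.
Qed.

Section Seminorm.
Variables (R : realType) (K : closedFieldType) (v : ultrametric_norm R K).
Implicit Types (s t : mseminorm v) (p q : {poly K}).

Lemma mseminorm0 s : s 0 = 0.
Proof. by rewrite -(rmorph0 polyC) mseminormC unorm0. Qed.

Lemma mseminorm1 s : s 1 = 1.
Proof. by rewrite -(rmorph1 polyC) mseminormC unorm1. Qed.

Lemma mseminormX s p n : s (p ^+ n) = s p ^+ n.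
Proof. by elim: n => [|n ih]; rewrite ?expr0 ?mseminorm1 // !exprS mseminormM ih. Qed.

Lemma mseminormZ s c p : s (c *: p) = v c * s p.
Proof. by rewrite -mul_polyC mseminormM mseminormC. Qed.

Lemma mseminormN s p : s (- p) = s p.
Proof. by rewrite -scaleN1r mseminormZ unormN unorm1 mul1r. Qed.

Lemma mseminormMn_le s p n : s (p *+ n) <= s p.
Proof.
rewrite -scaler_nat mseminormZ ler_piMl ?mseminorm_ge0 //.
exact: unorm_nat_le1.
Qed.

Lemma mseminorm_sum_le s (I : Type) (r : seq I) (F : I -> {poly K}) :
  s (\sum_(i <- r) F i) <= \sum_(i <- r) s (F i).
Proof.
elim: r => [|i r ih]; first by rewrite !big_nil mseminorm0.
by rewrite !big_cons (le_trans (mseminormD _ _ _)) // lerD2l.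
Qed.

(* [s (p + q) ^ n] is at most [n + 1] times the [n]-th power of the maximum. *)
Lemma mseminorm_ultra s p q : s (p + q) <= Num.max (s p) (s q).
Proof.
set M := Num.max _ _; have M0 : 0 <= M by rewrite le_max mseminorm_ge0.
have pw n : s (p + q) ^+ n <= n.+1%:R * M ^+ n.
  rewrite -mseminormX exprDn; apply: le_trans (mseminorm_sum_le _ _ _) _.
  have -> : n.+1%:R * M ^+ n = \sum_(i < n.+1) M ^+ n.
    by rewrite sumr_const card_ord mulr_natl.
  apply: ler_sum => i _; apply: le_trans (mseminormMn_le _ _ _) _.
  rewrite mseminormM !mseminormX; have -> : M ^+ n = M ^+ (n - i) * M ^+ i.
    by rewrite -exprD subnK // -ltnS.
  by apply: ler_pM; rewrite ?exprn_ge0 ?mseminorm_ge0 ?lerXn2r ?nnegrE ?mseminorm_ge0 //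
    le_max lexx ?orbT.
rewrite leNgt; apply/negP => hM; move: M0; rewrite le_eqVlt => /orP[/eqP M0|M0].
  by have := pw 1%N; rewrite !expr1 -M0 mulr0 leNgt M0 hM.
have [n hn] : exists n, n.+1%:R < (s (p + q) / M) ^+ n.
  by apply: exprn_dominates; rewrite ltr_pdivlMr ?mul1r.
by move: hn; rewrite exprMn exprVn ltr_pdivlMr ?exprn_gt0 // ltNge pw.
Qed.

Lemma mseminormD_le s p q r : s p <= r -> s q <= r -> s (p + q) <= r.
Proof. by move=> hp hq; apply: le_trans (mseminorm_ultra _ _ _) _; rewrite ge_max hp. Qed.

Lemma mseminormDl s p q : s q < s p -> s (p + q) = s p.
Proof.
move=> h; apply/eqP; rewrite eq_le mseminormD_le ?(ltW h) //= leNgt.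
apply/negP => h1; have : s (p + q - q) < s p.
  by apply: le_lt_trans (mseminorm_ultra _ _ _) _; rewrite mseminormN gt_max h1.
by rewrite addrK ltxx.
Qed.

Lemma XsubC_shift (a b : K) : 'X - b%:P = ('X - a%:P) + (a - b)%:P.
Proof. by rewrite polyCB addrA subrK. Qed.

Lemma mseminorm_XsubC_neq s a b : s ('X - a%:P) != v (a - b) ->
  s ('X - b%:P) = Num.max (s ('X - a%:P)) (v (a - b)).
Proof.
rewrite (XsubC_shift a b) neq_lt => /orP[] h; last first.
  by rewrite mseminormDl ?mseminormC // max_l // ltW.
by rewrite addrC mseminormDl ?mseminormC // max_r // ltW.
Qed.

Lemma mseminorm_XsubC_le s a b :
  s ('X - b%:P) <= Num.max (s ('X - a%:P)) (v (a - b)).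
Proof. by rewrite (XsubC_shift a b) -(mseminormC s (a - b)) mseminorm_ultra. Qed.

Lemma mseminorm_eq s t : s =1 t -> s = t.
Proof.
case: s => f f0 fC fM fD; case: t => g g0 gC gM gD /= /funext fg; subst g.
by congr MSeminorm; exact: Prop_irrelevance.
Qed.

Lemma mseminorm_split p : exists rs, forall s,
  s p = v (lead_coef p) * \prod_(z <- rs) s ('X - z%:P).
Proof.
have [rs prs] := closed_field_poly_normal p; exists rs => s.
rewrite {1}prs mseminormZ; congr (_ * _).
by apply: (big_morph s (mseminormM s) (mseminorm1 s)).
Qed.

Lemma mseminorm_ext s t : (forall a, s ('X - a%:P) = t ('X - a%:P)) -> s = t.
Proof.
move=> st; apply: mseminorm_eq => p; have [rs prs] := mseminorm_split p.
by rewrite !prs; congr (_ * _); apply: eq_bigr.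
Qed.

(** A value outside the value group never equals [v (x - a)], so the ultrametric inequality
    determines the values at all ['X - a%:P], hence the whole seminorm. *)
Lemma mseminorm_irrational_unique s t (x : K) : ~ value_group v (s ('X - x%:P)) ->
  0 < s ('X - x%:P) -> s ('X - x%:P) = t ('X - x%:P) -> s = t.
Proof.
move=> ns s0 st; apply: mseminorm_ext => a.
have ne : s ('X - x%:P) != v (x - a).
  apply/eqP => e; apply: ns; exists (x - a) => //=; rewrite -(unorm_gt0 v) -e //.
by rewrite (mseminorm_XsubC_neq ne); rewrite st in ne *; rewrite (mseminorm_XsubC_neq ne).
Qed.

(** * Gauss norms and the points they define *)

Section Gauss.
Variable rho : R.
Hypothesis rho0 : 0 <= rho.

Definition gaussn p : R := \big[Num.max/0]_(i < size p) (v p`_i * rho ^+ i).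

Lemma gaussn_ge0 p : 0 <= gaussn p.
Proof.
rewrite /gaussn; elim/big_ind : _ => // [a b a0 b_gt0|i _]; first by rewrite le_max a0.
by rewrite mulr_ge0 ?unorm_ge0 ?exprn_ge0.
Qed.

Lemma gaussn_ge p i : v p`_i * rho ^+ i <= gaussn p.
Proof.
have [ip|pi] := ltnP i (size p); last by rewrite nth_default // unorm0 mul0r gaussn_ge0.
exact: (le_bigmax _ (fun i : 'I__ => v p`_i * rho ^+ i) (Ordinal ip)).
Qed.

Lemma gaussn_le p M : 0 <= M -> (forall i, v p`_i * rho ^+ i <= M) -> gaussn p <= M.
Proof. by move=> M0 h; rewrite /gaussn; apply/bigmax_leP; split. Qed.

Lemma gaussn_attained p : 0 < gaussn p -> exists i, v p`_i * rho ^+ i = gaussn p /\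
  forall j, (j < i)%N -> v p`_j * rho ^+ j < gaussn p.
Proof.
move=> g0; have ex : exists i, v p`_i * rho ^+ i == gaussn p.
  apply: contrapT => h; have : gaussn p < gaussn p; last by rewrite ltxx.
  rewrite {1}/gaussn; apply/bigmax_ltP; split=> // i _.
  rewrite lt_neqAle gaussn_ge andbT; apply/negP => e; apply: h; by exists i.
case: (ex_minnP ex) => i /eqP hi imin; exists i; split=> // j ji.
by rewrite lt_neqAle gaussn_ge andbT; apply/negP => /imin; rewrite leqNgt ji.
Qed.

Lemma gaussnC c : gaussn c%:P = v c.
Proof.
apply/eqP; rewrite eq_le; apply/andP; split; last first.
  by have := gaussn_ge c%:P 0; rewrite coefC eqxx mulr1.
apply: gaussn_le => [|i]; first exact: unorm_ge0.
rewrite coefC; case: i => [|i] /=; first by rewrite mulr1.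
by rewrite unorm0 mul0r unorm_ge0.
Qed.

Lemma gaussnD p q : gaussn (p + q) <= Num.max (gaussn p) (gaussn q).
Proof.
apply: gaussn_le => [|i]; first by rewrite le_max gaussn_ge0.
rewrite coefD; apply: le_trans (ler_wpM2r (exprn_ge0 _ rho0) (unormD _ _ _)) _.
by rewrite maxr_pMl ?exprn_ge0 // ge_max !le_max !gaussn_ge orbT.
Qed.

Lemma gaussnM_le p q : gaussn (p * q) <= gaussn p * gaussn q.
Proof.
apply: gaussn_le => [|i]; first by rewrite mulr_ge0 ?gaussn_ge0.
rewrite coefM; have [r0|r0] := ltP 0 (rho ^+ i); last first.
  have -> : rho ^+ i = 0 by apply/eqP; rewrite eq_le r0 exprn_ge0.
  by rewrite mulr0 mulr_ge0 ?gaussn_ge0.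
rewrite -ler_pdivlMr //; apply: unorm_sum_le => [|[j /= hj] _].
  by rewrite divr_ge0 ?mulr_ge0 ?gaussn_ge0 ?ltW.
rewrite ler_pdivlMr // unormM; have -> : rho ^+ i = rho ^+ j * rho ^+ (i - j).
  by rewrite -exprD subnKC.
rewrite mulrACA; apply: ler_pM; rewrite ?gaussn_ge ?mulr_ge0 ?unorm_ge0 ?exprn_ge0 //.
Qed.

(* Only one term of the coefficient of degree [i + j] has maximal norm, [i] and
   [j] being the least degrees at which the two factors attain their norms. *)
Lemma gaussnM p q : gaussn (p * q) = gaussn p * gaussn q.
Proof.
apply/eqP; rewrite eq_le gaussnM_le /=.
have [p0|p0] := ltP 0 (gaussn p); last first.
  by have -> : gaussn p = 0; [apply/eqP; rewrite eq_le p0 gaussn_ge0|rewrite mul0r gaussn_ge0].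
have [q0|q0] := ltP 0 (gaussn q); last first.
  by have -> : gaussn q = 0; [apply/eqP; rewrite eq_le q0 gaussn_ge0|rewrite mulr0 gaussn_ge0].
have [i [hi imin]] := gaussn_attained p0; have [j [hj jmin]] := gaussn_attained q0.
have pq0 : 0 < gaussn p * gaussn q by rewrite mulr_gt0.
apply: le_trans (gaussn_ge (p * q) (i + j)); rewrite -hi -hj mulrACA -exprD.
have rij : 0 < rho ^+ (i + j).
  rewrite lt_neqAle exprn_ge0 // andbT eq_sym; apply/negP => /eqP e.
  by move: pq0; rewrite -hi -hj mulrACA -exprD e mulr0 ltxx.
rewrite ler_pM2r // -unormM coefM.
have hl : (i < (i + j).+1)%N by rewrite ltnS leq_addr.
rewrite (bigD1 (Ordinal hl)) //= addKn.
rewrite (@unormDl _ _ v) //.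
have pos : 0 < v (p`_i * q`_j).
  by rewrite unormM -(pmulr_lgt0 _ rij) exprD mulrACA hi hj.
pose m := \big[Num.max/0]_(l < (i + j).+1 | l != Ordinal hl) v (p`_l * q`_(i + j - l)).
apply: (@le_lt_trans _ _ m).
  apply: unorm_sum_le => [|l hll]; last by apply: (le_bigmax_cond _ (fun l : 'I_ _ => v (p`_l * q`_(i + j - l)))).
  by rewrite /m; elim/big_ind : _ => // [a b a0 b_gt0|l _]; rewrite ?le_max ?a0 ?unorm_ge0.
apply/bigmax_ltP; split=> // -[l /= hl'] ne.
rewrite -(ltr_pM2r rij) !unormM.
have e1 : v p`_l * v q`_(i + j - l) * rho ^+ (i + j) =
   (v p`_l * rho ^+ l) * (v q`_(i + j - l) * rho ^+ (i + j - l)).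
  by rewrite mulrACA -exprD subnKC.
have e2 : v p`_i * v q`_j * rho ^+ (i + j) = gaussn p * gaussn q.
  by rewrite exprD mulrACA hi hj.
rewrite e1 e2.
have nel : l != i by apply: contraNneq ne => e; apply/eqP/val_inj.
move: nel; rewrite neq_ltn => /orP[li|il].
  apply: le_lt_trans (_ : (v p`_l * rho ^+ l) * gaussn q < _).
    by rewrite ler_wpM2l ?gaussn_ge // mulr_ge0 ?unorm_ge0 ?exprn_ge0.
  by rewrite ltr_pM2r // imin.
apply: le_lt_trans (_ : gaussn p * (v q`_(i + j - l) * rho ^+ (i + j - l)) < _).
  by rewrite ler_wpM2r ?gaussn_ge // mulr_ge0 ?unorm_ge0 ?exprn_ge0.
by rewrite ltr_pM2l // jmin // ltn_subLR // ltn_add2r.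
Qed.

End Gauss.

Section GaussPoint.
Variables (z : K) (rho : R).

(* The absolute value makes this a function of all real numbers [rho], as needed
   for a path. *)
Definition gauss_fun p := gaussn `|rho| (p \Po ('X + z%:P)).

Lemma gauss_ge0 p : 0 <= gauss_fun p. Proof. exact: gaussn_ge0. Qed.

Lemma gaussC c : gauss_fun c%:P = v c.
Proof. by rewrite /gauss_fun comp_polyC gaussnC. Qed.

Lemma gaussM p q : gauss_fun (p * q) = gauss_fun p * gauss_fun q.
Proof. by rewrite /gauss_fun comp_polyM gaussnM. Qed.

Lemma gaussD p q : gauss_fun (p + q) <= gauss_fun p + gauss_fun q.
Proof.
rewrite /gauss_fun comp_polyD; apply: le_trans (gaussnD _ _ _) _ => //.
by rewrite ge_max lerDl lerDr !gaussn_ge0.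
Qed.

(** The Berkovich point associated with the closed disk of centre [z] and radius [|rho|]. *)
Definition gauss_point : mseminorm v := MSeminorm gauss_ge0 gaussC gaussM gaussD.

Lemma gauss_XsubC a : gauss_point ('X - a%:P) = Num.max `|rho| (v (z - a)).
Proof.
rewrite /gauss_point /= /gauss_fun comp_polyB comp_polyX comp_polyC -addrA -polyCB.
apply/eqP; rewrite eq_le; apply/andP; split.
  apply: gaussn_le => [|i]; first by rewrite le_max normr_ge0.
  rewrite coefD coefX coefC; case: i => [|[|i]] /=.
  - by rewrite add0r expr0 mulr1 le_max lexx orbT.
  - by rewrite addr0 unorm1 mul1r expr1 le_max lexx.
  - by rewrite addr0 unorm0 mul0r le_max normr_ge0.
rewrite ge_max; apply/andP; split.
  have := gaussn_ge (normr_ge0 rho) ('X + (z - a)%:P) 1.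
  by rewrite coefD coefX coefC /= addr0 unorm1 mul1r.
have := gaussn_ge (normr_ge0 rho) ('X + (z - a)%:P) 0.
by rewrite coefD coefX coefC /= add0r mulr1.
Qed.

End GaussPoint.

Lemma gauss_point0 z : gauss_point z 0 = eval_mseminorm v z.
Proof.
apply: mseminorm_ext => a; rewrite gauss_XsubC normr0 /= hornerXsubC.
by rewrite max_r // unorm_ge0.
Qed.

Lemma gauss_point_recenter z x rho : v (z - x) <= `|rho| -> gauss_point z rho = gauss_point x rho.
Proof.
move=> h; apply: mseminorm_ext => a; rewrite !gauss_XsubC.
apply/eqP; rewrite eq_le !ge_max !le_max !lexx /=.
have h1 : v (z - a) <= Num.max (v (z - x)) (v (x - a)).
  by rewrite -[z - a](subrKA x) unormD.
have h2 : v (x - a) <= Num.max (v (x - z)) (v (z - a)).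
  by rewrite -[x - a](subrKA z) unormD.
move: h1 h2; rewrite (unorm_distC v x z) !le_max => /orP[]h1 /orP[]h2;
 by rewrite ?h1 ?h2 ?(le_trans h1 h) ?(le_trans h2 h) ?orbT.
Qed.

End Seminorm.

(** * Topology of the Berkovich line *)

Section BerkTopology.
Variables (R : realType) (K : closedFieldType) (v : ultrametric_norm R K).
Local Notation berk := (berk_affine_line v).
Local Notation ev := (fun (f : {poly K}) (s : berk) => (s : mseminorm v) f).

Lemma berk_eval_continuous f : continuous (ev f : berk -> R).
Proof.
move=> s; apply: (@continuous_comp berk {ptws {poly K} -> R} R
  (mseminorm_fun (v := v) : berk -> {ptws {poly K} -> R}) (@proj _ (fun _ => R) f)).
  exact: initial_continuous.
exact: proj_continuous.
Qed.

Lemma berk_cvgP (T : Type) (F : set_system T) (g : T -> berk) (s : berk) : Filter F ->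
  (forall f, (fun t => ev f (g t)) @ F --> ev f s) -> g @ F --> s.
Proof.
move=> fam h.
have h' : (fun t => (mseminorm_fun (g t : mseminorm v) : {ptws {poly K} -> R})) @ F -->
    (mseminorm_fun (s : mseminorm v) : {ptws {poly K} -> R}).
  apply/cvg_sup => f U [_ [[W oW <-]] /= Ws /filterS]; apply.
  by apply: (h f); exact: open_nbhs_nbhs.
move=> U [_ [[W oW <-]] /= Ws /filterS]; apply.
by apply: h'; exact: open_nbhs_nbhs.
Qed.

Lemma berk_continuous (T : topologicalType) (g : T -> berk) :
  (forall f, continuous (fun t => ev f (g t))) -> continuous g.
Proof. by move=> h t; apply: berk_cvgP => f; exact: h. Qed.

Lemma berk_hausdorff : hausdorff_space berk.
Proof.
move=> s t st; apply: mseminorm_eq => f.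
apply: (@norm_hausdorff R R) => A B sA tB.
have [u [/= uA uB]] := st _ _ (berk_eval_continuous sA) (berk_eval_continuous tB).
by exists (ev f u).
Qed.

Lemma push_continuous (P : {poly K}) : continuous (push_mseminorm P : berk -> berk).
Proof. by apply: berk_continuous => f; exact: berk_eval_continuous. Qed.

Lemma disk_seminorm_bounded (x : K) (M : R) (f : {poly K}) :
  exists C, forall s : mseminorm v, s ('X - x%:P) <= M -> s f <= C.
Proof.
have [rs ers] := mseminorm_split v f.
exists (v (lead_coef f) * \prod_(z <- rs) Num.max M (v (x - z))) => s sM.
rewrite ers ler_wpM2l ?unorm_ge0 //; apply: ler_prod => z _.
rewrite mseminorm_ge0 /=; apply: le_trans (mseminorm_XsubC_le s x z) _.
by rewrite ge_max !le_max sM lexx orbT.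
Qed.

Definition closed_berk_disk (x : K) (M : R) : set berk := [set s | ev ('X - x%:P) s <= M].

(** Along an ultrafilter on the disk every evaluation is bounded, hence convergent; the pointwise
    limit is again a multiplicative seminorm. *)
Lemma closed_berk_disk_compact x M : compact (closed_berk_disk x M).
Proof.
have /choice[C hC] := disk_seminorm_bounded x M.
rewrite compact_ultra => F FU FD.
have lim f : exists l, ev f @ F --> (l : R).
  have FC : (ev f @ F) `[0, C f]%classic.
    apply: (@filterS _ F _ (closed_berk_disk x M)) => // s sM.
    by rewrite /preimage /= in_itv /= (hC f s sM) andbT; exact: mseminorm_ge0.
  have [l [_ clF]] := @segment_compact R 0 (C f) _ (fmap_proper_filter _ _) FC.
  exists l => A lA; have [//|nA] := in_ultra_setVsetC (ev f @^-1` A) FU.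
  have /= nA' : (ev f @ F) (~` A) by exact: nA.
  by have [u [nu /nu]] := clF _ _ nA' lA.
have [g hg] := choice lim.
have uniq (a b : R) (h : berk -> R) : h @ F --> a -> h @ F --> b -> a = b.
  by move=> ha hb; apply: (cvg_unique (@norm_hausdorff _ R) ha hb).
have g0 f : 0 <= g f.
  by apply: (ler_cvg_to (cvg_cst 0) (hg f)); apply: nearW => s; exact: mseminorm_ge0.
have gC c : g c%:P = v c.
  apply: uniq (hg _) _; rewrite (_ : ev c%:P = fun=> v c); first exact: cvg_cst.
  by apply/funext => s; exact: mseminormC.
have gM f1 f2 : g (f1 * f2) = g f1 * g f2.
  apply: uniq (hg _) _; rewrite (_ : ev (f1 * f2) = fun s => ev f1 s * ev f2 s).
    exact: cvgM.
  by apply/funext => s; exact: mseminormM.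
have gD f1 f2 : g (f1 + f2) <= g f1 + g f2.
  apply: (ler_cvg_to (hg (f1 + f2)) (cvgD (hg f1) (hg f2))).
  by apply: nearW => s; exact: mseminormD.
exists (MSeminorm g0 gC gM gD); split.
  by apply: (ler_cvg_to (hg _) (cvg_cst M)); exact: FD.
by apply: (@berk_cvgP _ F id) => f; exact: hg.
Qed.

Lemma closed_berk_disk_closed x M : closed (closed_berk_disk x M).
Proof. by apply: compact_closed; [exact: berk_hausdorff|exact: closed_berk_disk_compact]. Qed.

Lemma open_berk_disk_open x r : open [set s : berk | ev ('X - x%:P) s < r].
Proof.
apply: (@open_comp _ _ (ev ('X - x%:P)) [set t | t < r]) => [s _|].
  exact: berk_eval_continuous.
exact: open_lt.
Qed.

Lemma open_berk_outside x r : open [set s : berk | r < ev ('X - x%:P) s].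
Proof.
apply: (@open_comp _ _ (ev ('X - x%:P)) [set t | r < t]) => [s _|].
  exact: berk_eval_continuous.
exact: open_gt.
Qed.

Hypothesis v_nontrivial : nontrivial_norm v.

(** With [a0] in [l] minimizing [s ('X - a0%:P) = r], the value at any [a] of [l] is the maximum of
    [r] and [v (a0 - a)]. A point at a distance from [a0] slightly greater than [r] has nearly the
    same distances to [l]. *)
Lemma approx_by_points (s : mseminorm v) (l : seq K) (e : R) : 0 < e ->
  exists w, forall a, a \in l -> `|v (w - a) - s ('X - a%:P)| < e.
Proof.
move=> e0; case: l => [|b l]; first by exists 0.
have [a0 a0l amin] : exists2 a0, a0 \in b :: l &
    forall a, a \in b :: l -> s ('X - a0%:P) <= s ('X - a%:P).
  elim: l b => [|c l ih] b.
    by exists b; rewrite ?mem_head // => a; rewrite inE => /eqP->.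
  have [a0 a0l amin] := ih c.
  have [h|h] := leP (s ('X - b%:P)) (s ('X - a0%:P)).
    exists b; rewrite ?mem_head // => a; rewrite inE => /orP[/eqP->//|/amin].
    exact: le_trans.
  exists a0; first by rewrite inE a0l orbT.
  by move=> a; rewrite inE => /orP[/eqP->|/amin //]; exact: ltW.
move: (b :: l) a0l amin => {b}l a0l amin; set r := s ('X - a0%:P) in amin.
have r0 : 0 <= r by exact: mseminorm_ge0.
(* [d] is a gap above [r], so that the excess over [r] does not affect the larger distances
   [v (a0 - a)]. *)
have [d d0 hd] : exists2 d, 0 < d & forall a, a \in l -> r < v (a0 - a) -> r + d <= v (a0 - a).
  elim: l {a0l amin} => [|a l [d d0 hd]]; first by exists 1.
  have [h|h] := ltP r (v (a0 - a)); last first.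
    by exists d => // c; rewrite inE => /orP[/eqP->|/hd //]; rewrite ltNge h.
  exists (Num.min d (v (a0 - a) - r)); first by rewrite lt_min d0 subr_gt0.
  move=> c; rewrite inE -lerBrDl ge_min => /orP[/eqP->|/hd hc /hc].
    by rewrite lexx orbT.
  by rewrite -lerBrDl => ->.
have zlt : r < r + Num.min d e by rewrite ltrDl lt_min d0.
have [z /andP[z1 z2]] := exists_unorm_between v_nontrivial (le_lt_trans r0 zlt) zlt.
exists (a0 + z) => a al; rewrite addrAC.
have [h|h] := ltP r (v (a0 - a)).
  have -> : v (a0 - a + z) = v (a0 - a).
    rewrite unormDl //; apply: lt_le_trans z2 _; apply: le_trans (hd _ al h).
    by rewrite lerD2l ge_min lexx.
  have -> : s ('X - a%:P) = v (a0 - a).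
    by rewrite (mseminorm_XsubC_neq (a := a0)) ?lt_eqF // max_r // ltW.
  by rewrite subrr normr0.
have -> : v (a0 - a + z) = v z by rewrite unormDr // (le_lt_trans h).
have -> : s ('X - a%:P) = r.
  apply/eqP; rewrite eq_le amin // andbT.
  by apply: le_trans (mseminorm_XsubC_le s a0 a) _; rewrite ge_max lexx.
rewrite ger0_norm ?subr_ge0 ?(ltW z1) // ltrBlDl (lt_le_trans z2) //.
by rewrite lerD2l ge_min lexx orbT.
Qed.

(** The filter is generated by finitely many approximate conditions on linear polynomials;
    convergence extends to all polynomials because they split. *)
Lemma classical_points_dense (s : berk) :
  exists F : set_system K, ProperFilter F /\
    (fun w => eval_mseminorm v w : berk) @ F --> s.
Proof.
pose D := [set le : seq K * R | 0 < le.2].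
pose B (le : seq K * R) : set K :=
  [set w | forall a, a \in le.1 -> `|v (w - a) - ev ('X - a%:P) s| < le.2].
have fam : ProperFilter (filter_from D B).
  apply: filter_from_proper.
    apply: filter_from_filter; first by exists ([::], 1); rewrite /D /=.
    move=> [l1 e1] [l2 e2]; rewrite /D /= => h1 h2.
    exists (l1 ++ l2, Num.min e1 e2); rewrite /= ?lt_min ?h1 // => w hw.
    by split=> a al; have /(_ a) := hw; rewrite /= mem_cat al ?orbT => /(_ isT);
      rewrite lt_min => /andP[].
  by move=> [l e] /= e0; exact: approx_by_points.
exists (filter_from D B); split=> //.
apply: berk_cvgP => f; have [rs ers] := mseminorm_split v f.
rewrite (_ : (fun _ => _) = fun w => v (lead_coef f) * \prod_(z <- rs) v (w - z)); last first.
  apply/funext => w; rewrite (ers (eval_mseminorm v w)); congr (_ * _).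
  by apply: eq_bigr => z _; rewrite /= hornerXsubC.
rewrite ers; apply: cvgM; first exact: cvg_cst.
elim: rs {ers} => [|z rs ih].
  rewrite big_nil (_ : (fun _ => _) = fun=> 1); first exact: cvg_cst.
  by apply/funext => w; rewrite big_nil.
rewrite big_cons (_ : (fun _ => _) = fun w => v (w - z) * \prod_(z <- rs) v (w - z)); last first.
  by apply/funext => w; rewrite big_cons.
apply: cvgM ih; apply/cvgrPdist_lt => e e0.
exists ([:: z], e) => // w /= hw; rewrite distrC; apply: hw; exact: mem_head.
Qed.

End BerkTopology.

(** * The Fatou component *)

Section FatouDisk.
Variables (R : realType) (K : closedFieldType) (v : ultrametric_norm R K).
Hypothesis v_nontrivial : nontrivial_norm v.
Local Notation berk := (berk_affine_line v).
Local Notation ev := (fun (f : {poly K}) (s : berk) => (s : mseminorm v) f).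

Lemma gauss_point_continuous (z : K) : continuous (gauss_point v z : R -> berk).
Proof.
apply: berk_continuous => f; have [rs ers] := mseminorm_split v f.
rewrite (_ : (fun _ => _) =
    fun t : R => v (lead_coef f) * \prod_(a <- rs) Num.max `|t| (v (z - a))); last first.
  apply/funext => t; rewrite (ers (gauss_point v z t)); congr (_ * _).
  by apply: eq_bigr => a _; rewrite gauss_XsubC.
move=> t; apply: cvgM; first exact: cvg_cst.
elim: rs {ers} => [|a rs ih].
  rewrite (_ : (fun _ => _) = fun=> 1); first by rewrite big_nil; exact: cvg_cst.
  by apply/funext => u; rewrite big_nil.
rewrite big_cons (_ : (fun _ => _) =
    fun t => Num.max `|t| (v (z - a)) * \prod_(a <- rs) Num.max `|t| (v (z - a))); last first.
  by apply/funext => u; rewrite big_cons.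
apply: cvgM ih; apply: (@continuous_max R R (fun t => `|t|) (fun=> v (z - a)) t).
  exact: norm_continuous.
exact: cst_continuous.
Qed.

Definition berk_disk (x : K) (r : R) : set (berk_proj_line v) :=
  [set Some s | s in [set s : berk | ev ('X - x%:P) s < r]].

Lemma berk_disk_open x r : open (berk_disk x r).
Proof. apply: one_point_compactification_open_some; exact: open_berk_disk_open. Qed.

Definition berk_codisk (x : K) (r : R) : set (berk_proj_line v) :=
  [set u | if u is Some s then r < ev ('X - x%:P) s else True].

Lemma berk_codisk_open x r : open (berk_codisk x r).
Proof.
rewrite openE => -[s /= rs|_]; last first.
  exists (@closed_berk_disk R K v x r).
    by split; [exact: closed_berk_disk_compact|exact: closed_berk_disk_closed].
  move=> u [[s /= ns <-]|->] //=.
  by rewrite ltNge; apply/negP.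
have : nbhs s [set t : berk | r < ev ('X - x%:P) t].
  by apply: open_nbhs_nbhs; split=> //; exact: open_berk_outside.
by apply: filterS.
Qed.

Lemma gauss_segment_connected (z : K) (t : R) :
  connected [set (Some (gauss_point v z u) : berk_proj_line v) | u in `[0, t]%classic].
Proof.
apply: connected_continuous_connected; first exact: segment_connected.
apply: continuous_subspaceT => u.
apply: (@continuous_comp R berk (berk_proj_line v) (gauss_point v z) Some).
  exact: gauss_point_continuous.
exact: one_point_compactification_some_continuous.
Qed.

Variables (P : {poly K}) (x : K) (r : R).
Hypotheses (r_gt0 : 0 < r) (r_irr : ~ value_group v r) (wd : wandering_disk v P x r).

Let act := poly_action (v := v) P.
Let push : berk -> berk := push_mseminorm P.
Let orb n := iter n (horner P) x.

Lemma iter_act n s : iter n act (Some s) = Some (iter n push s).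
Proof. by elim: n => [|n ih] //=; rewrite ih. Qed.

Lemma push_eval z : push (eval_mseminorm v z) = eval_mseminorm v P.[z].
Proof. by apply: mseminorm_eq => f /=; rewrite horner_comp. Qed.

Lemma iter_push_eval n z :
  iter n push (eval_mseminorm v z) = eval_mseminorm v (iter n (horner P) z).
Proof. by elim: n => [|n ih] //=; rewrite ih push_eval. Qed.

Lemma iter_push_continuous n : continuous (iter n push).
Proof.
elim: n => [|n ih] s; first exact: cvg_id.
by apply: (@continuous_comp _ _ _ (iter n push) push); [exact: ih|exact: push_continuous].
Qed.

(** For classical points this is [wandering_shrinks]; the closed condition passes to their
    limits. *)
Lemma push_disk_bounded n (s : berk) : ev ('X - x%:P) s < r ->
  ev ('X - (orb n)%:P) (iter n push s) <= 1.
Proof.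
move=> sr; have [F [fam Fs]] := classical_points_dense v_nontrivial s.
have c1 : (fun w => ev ('X - (orb n)%:P) (iter n push (eval_mseminorm v w : berk))) @ F -->
    ev ('X - (orb n)%:P) (iter n push s).
  apply: (@cvg_comp _ _ _ (fun w => iter n push (eval_mseminorm v w : berk))
    (ev ('X - (orb n)%:P)) F (nbhs (iter n push s))).
    apply: (@cvg_comp _ _ _ (fun w => eval_mseminorm v w : berk) (iter n push) F (nbhs s)) => //.
    exact: iter_push_continuous.
  exact: berk_eval_continuous.
apply: (closed_cvg [set t : R | t <= 1] (@closed_le R 1) _ _ c1).
have : F ((fun w => eval_mseminorm v w : berk) @^-1` [set t | ev ('X - x%:P) t < r]).
  apply: Fs; apply: open_nbhs_nbhs; split => //; exact: open_berk_disk_open.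
apply: filterS => w /=; rewrite hornerXsubC => /(wandering_shrinks wd n).
by rewrite iter_push_eval /= hornerXsubC.
Qed.

(** The images of the disk stay within distance [1] of a bounded orbit, hence omit all large powers
    of an element [y] of norm greater than [1]. *)
Lemma berk_disk_fatou u : berk_disk x r u -> fatou_set act u.
Proof.
move=> ur; exists (berk_disk x r); split=> //; first exact: berk_disk_open.
have [M hM] := wandering_bounded wd; have [y y1] := exists_unorm_gt1 v_nontrivial.
have [k hk] := exprn_unbounded (Num.max 1 M) y1.
move=> fin; apply: infinite_nat.
pose f n : berk_proj_line v := Some (eval_mseminorm v (y ^+ (k + n))).
rewrite (_ : [set: nat] = f @^-1` ~` \bigcup_(n in [set: nat]) iter n act @` berk_disk x r).
  apply: finite_preimage fin => n m _ _ [] /(congr1 (fun g : {poly K} -> R => g 'X)) /=.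
  by rewrite !hornerX !unormX => /(ieexprIn (lt_trans ltr01 y1) (negbT (gt_eqF y1)))/addnI.
apply/seteqP; split=> // n _ [m _ [_ [s sr <-]]].
rewrite iter_act => -[] e; have := push_disk_bounded m sr.
rewrite e /= hornerXsubC => h.
have : v (y ^+ (k + n)) <= Num.max 1 M.
  rewrite -(subrK (orb m) (y ^+ _)); apply: unormD_le; rewrite le_max ?h //.
  by rewrite hM orbT.
rewrite leNgt unormX (lt_le_trans hk) // ler_weXn2l ?(ltW y1) //.
exact: leq_addr.
Qed.

(** By compactness, annuli [r <= _ <= r2] meeting the complement of [V] for every [r2 > r] would
    have a cluster point with value [r]; since [r] is outside the value group, this point is [s]. *)
Lemma annulus_in_nbhs (s : berk) (V : set berk) : ev ('X - x%:P) s = r -> nbhs s V ->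
  exists2 r2, r < r2 & forall t, r <= ev ('X - x%:P) t -> ev ('X - x%:P) t <= r2 -> V t.
Proof.
move=> sr sV; apply: contrapT => no.
pose B (r2 : R) : set berk := [set t | [/\ r <= ev ('X - x%:P) t, ev ('X - x%:P) t <= r2 & ~ V t]].
have fam : ProperFilter (filter_from [set r2 | r < r2] B).
  apply: filter_from_proper.
    apply: filter_from_filter; first by exists (r + 1); rewrite /= ltrDl.
    move=> a b /= ra rb; exists (Num.min a b); first by rewrite /= lt_min ra.
    by move=> t [h1]; rewrite le_min => /andP[h2 h3] nV; split.
  move=> a /= ra; apply: contrapT => ne; apply: no; exists a => // t h1 h2.
  by apply: contrapT => nV; apply: ne; exists t.
have [t [_ clt]] : @closed_berk_disk R K v x (r + 1) `&` cluster (filter_from [set r2 | r < r2] B) !=set0.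
  apply: closed_berk_disk_compact; exists (r + 1); first by rewrite /= ltrDl.
  by move=> t [].
have Bin a : r < a -> filter_from [set r2 | r < r2] B (B a) by move=> ra; exists a.
have r1 : r < r + 1 by rewrite ltrDl.
have tr : ev ('X - x%:P) t = r.
  have [h|h|//] := ltgtP (ev ('X - x%:P) t) r.
    have nt : nbhs t [set u : berk | ev ('X - x%:P) u < r].
      by apply: open_nbhs_nbhs; split => //; exact: open_berk_disk_open.
    have [u [[h1 _ _] /= h2]] := clt _ _ (Bin _ r1) nt.
    by move: h1; rewrite leNgt h2.
  pose a := (r + ev ('X - x%:P) t) / 2.
  have [ra at_] : r < a /\ a < ev ('X - x%:P) t by rewrite /a !(midf_lt h).
  have nt : nbhs t [set u : berk | a < ev ('X - x%:P) u].
    by apply: open_nbhs_nbhs; split=> //; exact: open_berk_outside.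
  have [u [[_ h1 _] /= h2]] := clt _ _ (Bin a ra) nt.
  by move: h1; rewrite leNgt h2.
have st : s = t by apply: (@mseminorm_irrational_unique _ _ v s t x); rewrite ?sr ?tr.
have tV : nbhs t V by rewrite -st.
by have [u [[_ _ nV] /nV]] := clt _ _ (Bin _ r1) tV.
Qed.

(* Every seminorm [sg] has a preimage in [U] under some iterate: its approximations
   by classical points do by [wandering_covers], and the image of a compact annulus
   is closed. Of two images of the disk at distance greater than [1], one avoids
   [sg], so that these preimages do not lie in the disk itself. *)
Lemma boundary_not_fatou (s : berk) : ev ('X - x%:P) s = r -> ~ fatou_set act (Some s).
Proof.
move=> sr [U [oU Us]]; apply; apply: sub_finite_set (finite_set1 None).
move=> [sg|//] nsg; exfalso; apply: nsg.
have sV : nbhs s (Some @^-1` U).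
  apply: (@one_point_compactification_some_continuous berk s U).
  exact: open_nbhs_nbhs.
have [r2 rr2 hV] := annulus_in_nbhs sr sV.
have [n0 cov] := wandering_covers wd (ev ('X - 0%:P) sg + 1) rr2.
have [n [nn0 hn]] : exists n, (n0 <= n)%N /\ 1 < ev ('X - (orb n)%:P) sg.
  have [n1 [n2 [h1 h2 sep]]] := wandering_separated wd n0.
  have [k1|k1] := ltP 1 (ev ('X - (orb n1)%:P) sg); first by exists n1.
  have [k2|k2] := ltP 1 (ev ('X - (orb n2)%:P) sg); first by exists n2.
  exfalso; move: sep; rewrite -/(orb n1) -/(orb n2) ltNge => /negP; apply.
  rewrite -(mseminormC (sg : mseminorm v)).
  have -> : (orb n1 - orb n2)%:P = ('X - (orb n2)%:P) - ('X - (orb n1)%:P).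
    by rewrite polyCB; ring.
  by apply: mseminormD_le; rewrite ?mseminormN.
pose B : set berk := [set t | r <= ev ('X - x%:P) t /\ ev ('X - x%:P) t <= r2].
have Bc : compact B.
  apply: (subclosed_compact _ (@closed_berk_disk_compact _ _ v x r2)); last by move=> t [].
  rewrite (_ : B = ~` [set t : berk | ev ('X - x%:P) t < r] `&` @closed_berk_disk R K v x r2).
    apply: closedI; last exact: closed_berk_disk_closed.
    by apply: open_closedC; exact: open_berk_disk_open.
  apply/seteqP; split=> t [h1 h2]; split=> //.
    by apply/negP; rewrite -leNgt.
  by rewrite leNgt; apply/negP.
have QB : closed (iter n push @` B).
  apply: compact_closed; first exact: berk_hausdorff.
  apply: continuous_compact Bc; apply: continuous_subspaceT.
  exact: iter_push_continuous.
have [F [fam Fs]] := classical_points_dense v_nontrivial sg.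
have [t [t1 t2] tsg] : (iter n push @` B) sg.
  apply: (closed_cvg _ QB _ _ Fs).
  have F1 : F ((fun w => eval_mseminorm v w : berk) @^-1`
      [set t | ev ('X - 0%:P) t < ev ('X - 0%:P) sg + 1]).
    apply: Fs; apply: open_nbhs_nbhs; split; first exact: open_berk_disk_open.
    by rewrite /= ltrDl.
  have F2 : F ((fun w => eval_mseminorm v w : berk) @^-1` [set t | 1 < ev ('X - (orb n)%:P) t]).
    by apply: Fs; apply: open_nbhs_nbhs; split=> //; exact: open_berk_outside.
  apply: filterS2 F1 F2 => w /=; rewrite !hornerXsubC subr0 => wS wn.
  have [z hz zw] := cov n nn0 w (ltW wS).
  exists (eval_mseminorm v z); last by rewrite iter_push_eval zw.
  rewrite /B /= hornerXsubC; split; last exact: ltW.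
  rewrite leNgt; apply/negP => /(wandering_shrinks wd n).
  by rewrite zw leNgt wn.
exists n => //; exists (Some t); first exact: hV.
by rewrite iter_act tsg.
Qed.

Let U := connected_component (fatou_set act) (berk_of_point v (Some x)).

Lemma center_in_disk : berk_disk x r (berk_of_point v (Some x)).
Proof. by exists (eval_mseminorm v x) => //=; rewrite hornerXsubC subrr unorm0. Qed.

(** The Fatou set contains no point at distance exactly [r] from [x]; it is therefore covered by two
    disjoint open sets, the disk and the codisk. *)
Lemma component_sub_disk : U `<=` berk_disk x r.
Proof.
have sep : separated (berk_disk x r) (berk_codisk x r).
  have disj : berk_disk x r `&` berk_codisk x r = set0.
    apply/seteqP; split=> // _ [[s /= sr <-]] /= rs.
    by have := lt_trans sr rs; rewrite ltxx.
  split.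
    apply/seteqP; split=> // u [h1 h2].
    have [w [w1 w2]] := h1 _ (open_nbhs_nbhs (conj (@berk_codisk_open x r) h2)).
    by have : (berk_disk x r `&` berk_codisk x r) w by []; rewrite disj.
  apply/seteqP; split=> // u [h2 h1].
  have [w [w1 w2]] := h1 _ (open_nbhs_nbhs (conj (@berk_disk_open x r) h2)).
  by have : (berk_disk x r `&` berk_codisk x r) w by []; rewrite disj.
have cov : U `<=` berk_disk x r `|` berk_codisk x r.
  move=> [s|] Us; last by right.
  have fs : fatou_set act (Some s) by exact: connected_component_sub Us.
  have [h|h|h] := ltgtP (ev ('X - x%:P) s) r.
  - by left; exists s.
  - by right.
  - by have := boundary_not_fatou h fs.
have Uc : connected U by exact: component_connected.
have [//|sub] := connected_subset sep cov Uc.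
have := sub _ (connected_component_refl (berk_disk_fatou center_in_disk)).
by rewrite /= hornerXsubC subrr unorm0 ltNge (ltW r_gt0).
Qed.

(** The segments of Gauss points issued from [x] and from [z] meet at radius [v (z - x)], without
    leaving the disk. *)
Lemma disk_sub_component z : v (z - x) < r -> U (berk_of_point v (Some z)).
Proof.
move=> zr; pose t := v (z - x).
pose seg (a : K) := [set (Some (gauss_point v a u) : berk_proj_line v) | u in `[0, t]%classic].
have t0 : 0 <= t by exact: unorm_ge0.
have pt a : seg a (berk_of_point v (Some a)).
  by exists 0; rewrite /= ?in_itv /= ?lexx //; rewrite gauss_point0.
have mid a : v (a - x) <= t -> seg a (Some (gauss_point v x t)).
  move=> ha; exists t; first by rewrite /= in_itv /= t0 lexx.
  by rewrite (@gauss_point_recenter _ _ v a x) // ger0_norm.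
have xx : v (x - x) <= t by rewrite subrr unorm0.
have segD a : v (a - x) <= t -> seg a `<=` fatou_set act.
  move=> ha w [u /=]; rewrite in_itv /= => /andP[u0 ut] <-; apply: berk_disk_fatou.
  exists (gauss_point v a u) => //.
  by rewrite /mkset (gauss_XsubC v a u x) gt_max ger0_norm // !(le_lt_trans _ zr).
apply: (@connected_component_max _ _ (seg x `|` seg z)).
- by left; exact: pt.
- by move=> u [] /segD; apply.
- apply: connectedU; rewrite ?gauss_segment_connected //; try exact: gauss_segment_connected.
  by exists (Some (gauss_point v x t)); split; apply: mid.
- by right; exact: pt.
Qed.

Lemma wandering_disk_component :
  [/\ fatou_component act U, ~ proj_points U None & affine_points U = open_disk v x r].
Proof.
split.
- exists (berk_of_point v (Some x)) => //; exact: berk_disk_fatou center_in_disk.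
- by move=> /component_sub_disk [].
- apply/seteqP; split=> z; last exact: disk_sub_component.
  by move=> /component_sub_disk [s /= sr [e]]; move: sr; rewrite e /= hornerXsubC.
Qed.

End FatouDisk.

(** * Diameters and irrational disks *)

Section Diameter.
Variables (R : realType) (K : closedFieldType) (v : ultrametric_norm R K).
Hypothesis v_nontrivial : nontrivial_norm v.

Lemma sup_dist_open_disk (x : K) (r : R) : 0 < r ->
  sup [set v (z - w) | z in open_disk v x r & w in open_disk v x r] = r.
Proof.
move=> r0; set S := [set _ | _ in _ & _ in _].
have ub t : S t -> t < r.
  move=> [z hz [w hw <-]]; apply: unorm_dist_lt hz _.
  by rewrite unorm_distC.
have Sx z : v (z - x) < r -> S (v (z - x)).
  by move=> hz; exists z => //; exists x => //; rewrite /open_disk /= subrr unorm0.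
have ne : S !=set0 by exists (v (x - x)); apply: Sx; rewrite subrr unorm0.
apply/eqP; rewrite eq_le; apply/andP; split.
  by apply: ge_sup => // t /ub /ltW.
rewrite leNgt; apply/negP => h.
have [e /andP[e1 e2]] := exists_unorm_between v_nontrivial r0 h.
have : v (x + e - x) <= sup S.
  apply: ub_le_sup; first by exists r => t /ub /ltW.
  by apply: Sx; rewrite addrC addKr.
by rewrite (addrC x) addrK leNgt e1.
Qed.

Lemma irrational_proj_disk_open_disk (x : K) (r : R) : 0 < r -> ~ value_group v r ->
  irrational_proj_disk v (Some @` open_disk v x r).
Proof.
move=> r0 nr; exists 1, 0, 0, 1, (open_disk v x r); split.
- by rewrite mul1r mul0r subr0 oner_eq0.
- by exists x, r.
have mob (z : K) : mobius 1 0 0 1 (Some z) = Some z.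
  by rewrite /mobius mul0r add0r oner_eq0 mul1r addr0 divr1.
apply/seteqP; split=> [_ [z hz <-]|_ [_ [z hz <-] <-]].
  by exists (Some z); [exists z|rewrite mob].
by rewrite mob; exists z.
Qed.

End Diameter.

Theorem theorem1 (R : realType) (K : closedFieldType)
  (v : ultrametric_norm R K)
  (v_nontrivial : nontrivial_norm v)
  (v_complete : complete_norm v)
  (v_residue : positive_residue_char v)
  (v_group : value_group v `<` [set r : R | 0 < r])
  (D : set R)
  (D_divisible : divisible_subgroup D)
  (D_proper : D `<` [set r : R | 0 < r])
  (D_group : value_group v `<=` D) :
  (exists (P : {poly K}) (U : set (berk_proj_line v)),
     [/\ (2 < size P)%N, fatou_component (poly_action P) U, bounded_in_K U &
         ~ D (diameter U)]) /\
  (exists (P : {poly K}) (U : set (berk_proj_line v)),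
     [/\ (2 < size P)%N, fatou_component (poly_action P) U &
         irrational_proj_disk v (proj_points U)]).
Proof.
have [P [x [r [sP r0 nDr wd]]]] :=
  exists_wandering_disk v_nontrivial v_complete v_residue D_divisible D_proper D_group.
have nr : ~ value_group v r by move=> /D_group.
have [] := wandering_disk_component v_nontrivial r0 nr wd.
set U := connected_component _ _ => fU Uinfty Ux.
split; exists P, U; split=> //.
- split=> //; first by exists x; rewrite Ux /open_disk /= subrr unorm0.
  exists (Num.max r (v x)) => z; rewrite Ux => /ltW h.
  by rewrite -(subrK x z); apply: unormD_le; rewrite le_max ?h ?lexx ?orbT.
- by rewrite /diameter Ux sup_dist_open_disk.
- rewrite (_ : proj_points U = Some @` open_disk v x r).
    exact: irrational_proj_disk_open_disk.
  rewrite -Ux; apply/seteqP; split=> [[z|//] Uz|_ [z Uz <-]] //.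
Qed.
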